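(* Let $d\ge 5$. (i) Let $F\subset \mathbb{P}^2$ be a smooth complex plane curve of degree $d$, and let $\xi\in H^1(F,T_F)$, $\xi\neq 0$, be an infinitesimal deformation of $F$ that preserves the planarity of $F$ (an infinitesimal deformation of $F$ as a smooth plane curve). Then the rank of the cup-product map $$ H^0(F,\omega_F) \xrightarrow{\ \cdot\, \xi\ } H^1(F,\mathcal{O}_F) $$ is at least $d-3$. (ii) This bound is realized for the Fermat curve: if $F=\{x^d+y^d+z^d=0\}\subset\mathbb{P}^2$, there exists a nonzero infinitesimal deformation $\xi\in H^1(F,T_F)$ of $F$ preserving the planarity of $F$ such that the map $\cdot\,\xi: H^0(F,\omega_F)\to H^1(F,\mathcal{O}_F)$ has rank exactly $d-3$.
   Context: Everything is over $\mathbb{C}$; $T_F$ is the tangent bundle and $\omega_F$ the canonical bundle of $F$. The map $\cdot\,\xi$ is the cup product with $\xi\in H^1(F,T_F)$ followed by the contraction $T_F\otimes\omega_F\to\mathcal{O}_F$. The infinitesimal deformations of $F$ preserving the planarity of $F$ are the elements of the image of the coboundary map $H^0(F,N_{F/\mathbb{P}^2})\to H^1(F,T_F)$ of the normal bundle sequence $0\to T_F\to T_{\mathbb{P}^2}|_F\to N_{F/\mathbb{P}^2}\to 0$, i.e. the first-order deformations of $F$ induced by first-order deformations of $F$ inside $\mathbb{P}^2$. Equivalent algebraic description used in the paper (due to Griffiths): if $F$ is the zero locus of a homogeneous $f\in S=\mathbb{C}[x,y,z]$ of degree $d$, let $J=(f_x,f_y,f_z)$ be the Jacobian ideal generated by the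 partial derivatives and $R=S/J=\bigoplus_n R^n$ the Jacobian ring, where $S^n$ and $R^n$ denote the degree $n$ parts. Then $H^0(F,\omega_F)\simeq S^{d-3}=R^{d-3}$, $H^1(F,\mathcal{O}_F)\simeq R^{2d-3}$, the subspace of $H^1(F,T_F)$ of infinitesimal deformations preserving the planarity of $F$ is isomorphic to $R^d$, and under these identifications the cup product corresponds to multiplication in $R$. Thus the map $\cdot\,\xi$ becomes the multiplication map $R^{d-3}\xrightarrow{\cdot\xi}R^{2d-3}$ by a nonzero element $\xi\in R^d$. *)

(* Defs.v *)
From HB Require Import structures.
From mathcomp Require Import all_boot all_order all_algebra.
From mathcomp Require Import fraction complex reals mpoly.

Set Implicit Arguments.
Unset Strict Implicit.
Unset Printing Implicit Defensive.

Import Order.TTheory GRing.Theory Num.Theory.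
Local Open Scope ring_scope.
Local Open Scope complex_scope.

(* Let F = {f = 0} be a curve of degree d in P^2 over C = R[i].  A coherent
   sheaf E on F is handled through its sections on the standard affine opens
   U_I = {p in F | x_i(p) != 0 for all i in I}, and its cohomology is the Cech
   cohomology of the affine cover U_0, U_1, U_2 of F.
   The polynomial ring S = C[x_0, x_1, x_2] is a domain, so all its
   localizations S[1/x_I], x_I = \prod_(i in I) x_i, live in K = Frac S. *)

Definition ratK (R : realType) := {fraction {mpoly R[i][3]}}.

Definition toK (R : realType) (p : {mpoly R[i][3]}) : ratK R :=
  @FracField.tofrac {mpoly R[i][3]} p.

Definition constK (R : realType) (c : R[i]) : ratK R := toK (c%:MP_[3]).

Definition smooth_plane_curve (R : realType) (d : nat) (f : {mpoly R[i][3]}) : Prop :=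
  f \is d.-homog /\
  forall p : 'I_3 -> R[i], (exists i, p i != 0) -> f.@[p] = 0 ->
    exists i : 'I_3, (f^`M(i)).@[p] != 0.

Definition fermat (R : realType) (d : nat) : {mpoly R[i][3]} :=
  \sum_(i < 3) 'X_i ^+ d.

(* The degree n part of the localization S[1/x_I]. *)
Definition loc (R : realType) (I : {set 'I_3}) (n : int) (q : ratK R) : Prop :=
  exists (k m : nat) (g : {mpoly R[i][3]}),
    [/\ g \is m.-homog, m%:Z = n + (k * #|I|)%:Z
      & q = toK g / toK (\prod_(i in I) 'X_i) ^+ k].

(* A sheaf given by subquotients: E(U_I) = sec I / nul I, for I nonempty.  The
   restriction from U_I to a smaller U_J is induced by the identity of amb. *)
Record sheaf (R : realType) := Sheaf {
  amb : lmodType (ratK R);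
  sec : {set 'I_3} -> amb -> Prop;
  nul : {set 'I_3} -> amb -> Prop }.

Section Cech.
Variables (R : realType) (E : sheaf R).

Definition H0 (s : 'I_3 -> amb E) : Prop :=
  (forall a, sec [set a] (s a)) /\
  (forall a b, nul [set a; b] (s a - s b)).

Definition Z1 (c : 'I_3 -> 'I_3 -> amb E) : Prop :=
  (forall a b, sec [set a; b] (c a b)) /\
  (forall a b e, nul [set a; b; e] (c a b + c b e - c a e)).

(* H^1 is Z1 modulo B1: a cocycle has nonzero class iff it is not in B1. *)
Definition B1 (c : 'I_3 -> 'I_3 -> amb E) : Prop :=
  exists s : 'I_3 -> amb E,
    (forall a, sec [set a] (s a)) /\
    (forall a b, nul [set a; b] (c a b - (s b - s a))).

End Cech.

(* phi is a C-linear map H^0(A) -> H^1(B), given on cocycles. *)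
Definition rank_at_least (R : realType) (A B : sheaf R)
    (phi : ('I_3 -> amb A) -> 'I_3 -> 'I_3 -> amb B) (r : nat) : Prop :=
  exists w : 'I_r -> 'I_3 -> amb A,
    (forall k, H0 (w k)) /\
    forall c : 'I_r -> R[i],
      B1 (fun a b => \sum_(k < r) constK (c k) *: phi (w k) a b) ->
      forall k, c k = 0.

Definition has_rank (R : realType) (A B : sheaf R)
    (phi : ('I_3 -> amb A) -> 'I_3 -> 'I_3 -> amb B) (r : nat) : Prop :=
  rank_at_least phi r /\ forall r', rank_at_least phi r' -> (r' <= r)%N.

Section PlaneCurve.
Variables (R : realType) (d : nat) (f : {mpoly R[i][3]}).

Let K := ratK R.
Definition xK (i : 'I_3) : K := toK 'X_i.
Definition fK : K := toK f.
Definition dfK (i : 'I_3) : K := toK (f^`M(i)).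

(* f . O(n - d) inside O(n): the sections of O_{P^2}(n) vanishing on F. *)
Definition van (n : int) (I : {set 'I_3}) (q : K) : Prop :=
  exists t : K, loc I (n - d%:Z) t /\ q = fK * t.

(* The line bundle O_F(n). *)
Definition OF (n : int) : sheaf R := @Sheaf R K^o (fun I => loc I n) (van n).

(* T_{P^2}|_F by the Euler sequence 0 -> O_F -> O_F(1)^3 -> T_{P^2}|_F -> 0: the
   row v stands for the vector field \sum_i v_i d/dx_i, and the image of O_F
   consists of the multiples of the Euler field \sum_i x_i d/dx_i. *)
Definition nulT (I : {set 'I_3}) (v : 'rV[K]_3) : Prop :=
  exists c : K, loc I 0 c /\ forall i, van 1 I (v 0 i - c * xK i).

Definition TP2F : sheaf R :=
  @Sheaf R 'rV[K]_3 (fun I v => forall i, loc I 1 (v 0 i)) nulT.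

(* The normal bundle N_{F/P^2} = O_F(d), via the generator f of the ideal of F,
   and the map T_{P^2}|_F -> N_{F/P^2}, v |-> v(f). *)
Definition NF : sheaf R := OF d%:Z.
Definition toN (v : 'rV[K]_3) : K := \sum_i dfK i * v 0 i.

(* T_F = ker (T_{P^2}|_F -> N_{F/P^2}). *)
Definition TF : sheaf R :=
  @Sheaf R 'rV[K]_3
    (fun I v => (forall i, loc I 1 (v 0 i)) /\ van d%:Z I (toN v)) nulT.

(* The row w stands for the form \sum_i w_i dx_i.  The dual Euler sequence
   0 -> Omega_{P^2}|_F -> O_F(-1)^3 -> O_F -> 0 gives the sections, and
   omega_F = Omega^1_F is the quotient of Omega_{P^2}|_F by the image O_F(-d) df
   of the conormal bundle. *)
Definition omegaF : sheaf R :=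
  @Sheaf R 'rV[K]_3
    (fun I w => (forall i, loc I (-1) (w 0 i)) /\
                van 0 I (\sum_i w 0 i * xK i))
    (fun I w => exists u : K, loc I (- d%:Z) u /\
                forall i, van (-1) I (w 0 i - u * dfK i)).

(* Cup product with xi : H^0(omega_F) -> H^1(omega_F (x) T_F), followed by the
   contraction to O_F. *)
Definition cup (xi : 'I_3 -> 'I_3 -> amb TF) (w : 'I_3 -> amb omegaF)
    (a b : 'I_3) : amb (OF 0) :=
  \sum_i (w a : 'rV[K]_3) 0 i * (xi a b : 'rV[K]_3) 0 i.

(* The class of xi in H^1(T_F) is the image of some s in H^0(N_{F/P^2}) under
   the coboundary of 0 -> T_F -> T_{P^2}|_F -> N_{F/P^2} -> 0: the v a are local
   lifts of s to T_{P^2}|_F. *)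
Definition preserves_planarity (xi : 'I_3 -> 'I_3 -> amb TF) : Prop :=
  exists (s : 'I_3 -> amb NF) (v : 'I_3 -> 'rV[K]_3),
    [/\ H0 s,
        forall a, @sec R TP2F [set a] (v a),
        forall a, @nul R NF [set a] (toN (v a) - s a)
      & @B1 R TF (fun a b => xi a b - (v b - v a))].

(* A nonzero element of H^1(F, T_F) preserving the planarity of F. *)
Definition planar_deformation (xi : 'I_3 -> 'I_3 -> amb TF) : Prop :=
  [/\ Z1 xi, ~ B1 xi & preserves_planarity xi].

End PlaneCurve.

(* Main.v *)
Require Import Defs.
From HB Require Import structures.
From mathcomp Require Import all_boot all_order all_algebra.
From mathcomp Require Import fraction complex reals mpoly.
From mathcomp Require Import boolp spectral zify ring.
Set Implicit Arguments.
Unset Strict Implicit.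
Unset Printing Implicit Defensive.
Local Open Scope ring_scope.
Local Open Scope complex_scope.

(** Let S = C[x_0, x_1, x_2], let f' = (f_0, f_1, f_2) be the gradient of f and
    J = (f_0, f_1, f_2) its Jacobian ideal; X denotes the vector (x_0, x_1, x_2),
    and . and * the dot and cross products of vectors of rational functions.

    Translation into algebra.  As F is smooth, the Nullstellensatz gives on
    every chart U_a a vector alpha^a with alpha^a . f' = 1 (inverse_gradient).
    A form g of degree d - 3 defines the section of omega_F equal to
    g (alpha^a * X) . dX on U_a, and two of these expressions differ by
    - g ((alpha^a * alpha^b) . X) df modulo f.  A planar deformation xi is, up to
    coboundaries, v_b - v_a where v_a(f) = s modulo f for one form s of degree d,
    so the product of xi with the section of g is cohomologous to
    - g s ((alpha^a * alpha^b) . X) (cup_class).  Its image in H^2(P^2, O(-d)) is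
    - d g s det, where det = det(alpha^0, alpha^1, alpha^2): a vanishing product
    forces g s det to be a sum of functions each regular off two of the
    coordinate lines (cup_B1_trivial).  Writing det = D / (x_0 x_1 x_2)^(N+1),
    such sums are detected by the functional phi(P) = coefficient of
    (x_0 x_1 x_2)^N in P D.  It kills J since f_i det is such a sum, and
    conversely P lies in J as soon as phi(P S) = 0: a gluing argument for
    P alpha^a, using that H^1(P^2, O(n)) = 0 (local_duality).  Hence xi <> 0 makes
    psi(Q) = phi(s Q) a nonzero functional, concentrated in degree 2m with
    m = d - 3, and the rank of the cup product is at least that of the bilinear
    form (g, h) |-> psi(g h) on forms of degree m.

    The bound.  Let A be the quotient of S by the ideal annihilated by psi; it is
    a graded Gorenstein algebra with socle in degree 2m, and dim A_m >= m has to
    be shown.  Multiplication by a generic linear form a is injective on A_k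
    unless dim A_k > 2m - k: if a w = 0 with w <> 0 in A_k, then w deforms to a
    kernel vector of a + t b, which puts b^j w in a^j A_k, so that the spaces
    a^j A_k drop in dimension for j = 0, ..., 2m - k (generic_injective).  If
    dim A_m < m, this applies in degrees m and m + 1 and, by the duality between
    injectivity and surjectivity, makes A_m -> A_(m+1) -> A_(m+2) bijective for
    some a.  The operators x_i / a on A_m then commute, and a common eigenvector
    is a point p at which all elements of degree m + 2 of the ideal vanish
    (common_zero).  Among these are the f_i, of degree d - 1 = m + 2, which have
    no common zero.

    Sharpness.  For the Fermat curve take s = x_0^2 x_1^(d-2).  Every section w of
    omega_F has a class tau in H^2(P^2, O(-2d)) killed by the f_i, hence by the
    x_i^(d-1), and w xi vanishes when s tau does (cup_coboundary).  A Laurent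
    monomial that occurs in tau and survives multiplication by s has exponent
    - d + 1 in x_1 and between - d + 1 and - 3 in x_0; this leaves d - 3 linear
    conditions on w (fermat_rank_upper). *)

Import Order.TTheory GRing.Theory Num.Theory.

(** * Kernel vectors in a pencil of matrices *)

Lemma poly_fun_eq0 (F : numDomainType) (p : {poly F}) :
  (forall t, p.[t] = 0) -> p = 0.
Proof.
move=> p0; apply/eqP/negPn/negP => pN0.
pose s : seq F := [seq i%:R | i <- iota 0 (size p)].
have : (size s < size p)%N.
  apply: max_poly_roots => //.
    by apply/allP => _ /mapP[i _ ->]; rewrite rootE p0.
  by rewrite map_inj_uniq ?iota_uniq // => i j /eqP; rewrite eqr_nat => /eqP.
by rewrite size_map size_iota ltnn.
Qed.

(** The columns of Z then lie in the column space of M, which E annihilates. *)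
Lemma rank_le_col (F : fieldType) p q r (M : 'M[F]_(p, q)) (Z : 'M_(p, r))
    (E : 'M_p) :
  (\rank (row_mx M Z) <= \rank M)%N -> E *m M = 0 -> E *m Z = 0.
Proof.
move=> rk EM.
have sub : (M^T <= (row_mx M Z)^T)%MS.
  by rewrite tr_row_mx -addsmxE addsmxSl.
have : ((row_mx M Z)^T <= M^T)%MS.
  rewrite -(geq_leqif (mxrank_leqif_sup sub)).
  by rewrite !mxrank_tr.
rewrite tr_row_mx => sup.
have /submxP[Y ZY] : (Z^T <= M^T)%MS.
  by apply: submx_trans sup; rewrite -addsmxE addsmxSr.
have -> : Z = M *m Y^T by apply: trmx_inj; rewrite trmx_mul trmxK.
by rewrite mulmxA EM mul0mx.
Qed.

(** A kernel vector at a point of maximal rank of the pencil M + t N extends to a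
    formal family of kernel vectors, since there the kernel has locally constant
    dimension; the w i are the coefficients of such a family. *)
Lemma kernel_deformation (F : numFieldType) p q (M N : 'M[F]_(p, q))
    (u : 'rV_p) :
    (forall t, \rank (M + t *: N)%R <= \rank M)%N -> u *m M = 0 ->
  exists2 w : nat -> 'rV_p,
    w 0%N = u & forall i, w i.+1 *m M = - (w i *m N).
Proof.
move=> rk uM; move: (pinvmx M) (mulmxKpV (submx_refl M)) => M' MK.
(* E and G project onto the left and the right kernel of M. *)
pose E := 1%:M - M *m M'; pose G := 1%:M - M' *m M.
have EM : E *m M = 0 by rewrite mulmxBl mul1mx MK subrr.
have uE : u *m E = u by rewrite mulmxBr mulmx1 mulmxA uM mul0mx subr0.
have GM : G *m (M' *m M) = 0.
  by rewrite mulmxBl mul1mx -(mulmxA M' M) (mulmxA M M') MK subrr.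
have GG : G *m G = G by rewrite {2}/G mulmxBr GM mulmx1 subr0.
have MG : M *m G = 0 by rewrite mulmxBr mulmx1 mulmxA MK subrr.
have MG1 : M' *m M + G = 1%:M by rewrite addrC subrK.
pose c a b (A : 'M[F]_(a, b)) := map_mx polyC A.
pose D : 'M[{poly F}]_p := 1%:M + 'X *: c _ _ (N *m M').
pose ev t : {rmorphism {poly F} -> F} := horner_eval t.
have evc a b (A : 'M[F]_(a, b)) t : map_mx (ev t) (c _ _ A) = A.
  by apply/matrixP => i j; rewrite !mxE /= /horner_eval hornerC.
have evD t : map_mx (ev t) D = 1%:M + t *: (N *m M').
  by rewrite map_mxD map_mx1 map_mxZ evc /= /horner_eval hornerX.
(* Where D(t) is invertible, M + t N = D(t) (M + t D(t)^-1 N G), and the rank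
   hypothesis puts the columns of D(t)^-1 N G in the column space of M.  The
   adjugate clears the denominators. *)
have ED : c _ _ E *m \adj D *m c _ _ (N *m G) = 0.
  apply/matrixP => i j; rewrite [RHS]mxE.
  set P := (X in X = 0).
  have : 'X * \det D * P = 0.
    apply: poly_fun_eq0 => t; rewrite !hornerM hornerX.
    have [->|t0] := eqVneq t 0; first by rewrite !mul0r.
    have [->|dt] := eqVneq (\det D).[t] 0; first by rewrite mulr0 mul0r.
    suff -> : P.[t] = 0 by rewrite mulr0.
    have -> : P.[t] = (E *m \adj (map_mx (ev t) D) *m (N *m G)) i j.
      rewrite -{1}(evc _ _ E t) -{1}(evc _ _ (N *m G) t).
      by rewrite -map_mx_adj -!map_mxM [RHS]mxE.
    have dDt : \det (map_mx (ev t) D) = (\det D).[t] by rewrite det_map_mx.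
    move: dDt; rewrite evD; set Dt := 1%:M + _ => dDt.
    have uDt : Dt \in unitmx by rewrite unitmxE dDt unitfE.
    have MN : M + t *: N = Dt *m (M + t *: (invmx Dt *m (N *m G))).
      rewrite mulmxDr -scalemxAr mulKVmx // mulmxDl mul1mx -scalemxAl.
      rewrite -mulmxA -addrA -scalerDr -mulmxDr.
      by rewrite MG1 mulmx1.
    set Z := t *: (invmx _ *m _) in MN.
    have ZG : Z *m G = Z by rewrite /Z -scalemxAl -!mulmxA GG.
    have ZM : Z *m (M' *m M) = 0 by rewrite /Z -scalemxAl -!mulmxA GM !mulmx0 scaler0.
    have : (\rank (row_mx M Z) <= \rank M)%N.
      apply: leq_trans (rk t); rewrite MN.
      have /eqmxMfull -> : row_full Dt by rewrite row_full_unit.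
      have -> : row_mx M Z = (M + Z) *m row_mx (M' *m M) G.
        by rewrite mul_mx_row !mulmxDl ZG ZM MG addr0 add0r mulmxA MK.
      exact: mxrankM_maxl.
    move=> /rank_le_col/(_ EM); rewrite /Z -scalemxAr => /eqP.
    rewrite scaler_eq0 (negPf t0) /= => /eqP EZ.
    have -> : \adj Dt = \det Dt *: invmx Dt.
      by rewrite /invmx uDt scalerA divff ?scale1r // dDt.
    by rewrite -scalemxAr -scalemxAl -mulmxA EZ scaler0 mxE.
  move/eqP; rewrite !mulf_eq0 polyX_eq0 /= => /orP[/eqP dD|/eqP //].
  have := det_map_mx (ev 0) D; rewrite evD scale0r addr0 det1 dD.
  by rewrite rmorph0 => /eqP; rewrite oner_eq0.
(* The polynomial family of kernel vectors; W(0) = u because D(0) = 1. *)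
pose W := c _ _ u *m \adj D.
have WMN : W *m (c _ _ M + 'X *: c _ _ N) = 0.
  have -> : c _ _ M + 'X *: c _ _ N = D *m c _ _ M + 'X *: c _ _ (N *m G).
    rewrite mulmxDl mul1mx -scalemxAl -addrA -scalerDr /c -!map_mxM -map_mxD.
    by rewrite -mulmxA -mulmxDr MG1 mulmx1.
  rewrite mulmxDr mulmxA -(mulmxA (c _ _ u)) mul_adj_mx mul_mx_scalar -scalemxAl.
  rewrite /c -map_mxM uM raddf0 scaler0 add0r -scalemxAr.
  by rewrite /W -uE /c map_mxM -/(c _ _ u) -!mulmxA (mulmxA (c _ _ E)) ED mulmx0 scaler0.
exists (fun i => \row_j (W 0 j)`_i).
  have W0 : map_mx (ev 0) W = u.
    by rewrite map_mxM evc map_mx_adj evD scale0r addr0 adj1 mulmx1.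
  by apply/rowP => j; rewrite -W0 !mxE /= /horner_eval horner_coef0.
move=> i; apply/rowP => j.
have /rowP/(_ j)/(congr1 (fun r : {poly F} => r`_i.+1)) := WMN.
rewrite mulmxDr -scalemxAr !mxE coefD coefXM coef0 !coef_sum /= => /eqP.
rewrite addr_eq0 => /eqP H.
transitivity (\sum_k (W 0 k * c _ _ M k j)`_i.+1).
  by apply: eq_bigr => k _; rewrite [c _ _ M _ _]mxE coefMC mxE.
rewrite H; congr (- _); apply: eq_bigr => k _.
by rewrite [c _ _ N _ _]mxE coefMC mxE.
Qed.

(** * Functionals on polynomials and their catalecticants *)

Definition lform (C : nzRingType) n (b : 'I_n -> C) : {mpoly C[n]} :=
  \sum_i b i *: 'X_i.

Lemma lform_homog (C : nzRingType) n (b : 'I_n -> C) : lform b \is 1.-homog.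
Proof.
by apply: rpred_sum => i _; apply: rpredZ; rewrite dhomogX /= mdeg1.
Qed.

Lemma homog_mulX (C : nzRingType) n i k (P : {mpoly C[n]}) :
  P \is k.-homog -> 'X_i * P \is k.+1.-homog.
Proof.
by move=> hP; rewrite -add1n; apply: dhomogM hP; rewrite dhomogX /= mdeg1.
Qed.

Lemma homog_mul_lform (C : nzRingType) n (b : 'I_n -> C) k (P : {mpoly C[n]}) :
  P \is k.-homog -> lform b * P \is k.+1.-homog.
Proof.
by move=> hP; rewrite -add1n; apply: dhomogM hP; apply: lform_homog.
Qed.

Lemma mnm_pred n k (mu : 'X_{1..n}) : mdeg mu = k.+1 ->
  exists i nu, mu = (U_(i) + nu)%MM /\ mdeg nu = k.
Proof.
move=> dmu; have [i mui] : exists i, mu i != 0%N.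
  apply/existsP; rewrite -negb_forall; apply/negP => /forallP H.
  have := dmu; rewrite mdegE big1 // => i _; exact/eqP/H.
have le_i : (U_(i) <= mu)%MM by rewrite lep1mP.
exists i, (mu - U_(i))%MM; rewrite addmC submK //; split => //.
by move: dmu; rewrite -{1}(submK le_i) mdegD mdeg1 addn1 => -[].
Qed.

(** In characteristic 0 the powers of linear forms span all forms of the same
    degree; here in the dual version, for a linear functional. *)
Lemma powers_span (C : numFieldType) n (psi : {scalar {mpoly C[n]}}) r P :
    (forall b, psi (lform b ^+ r * P) = 0) ->
  forall mu, mdeg mu = r -> psi ('X_[mu] * P) = 0.
Proof.
elim: r P => [|r IH] P H mu dmu.
  have /eqP -> : mu == 0%MM by rewrite -mdeg_eq0 dmu.
  by rewrite mpolyX0 -(H (fun=> 0)) expr0.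
have [i [nu [-> dnu]]] := mnm_pred dmu.
rewrite mpolyXD mulrC mulrA mulrC (mulrC P); apply: (IH) => // b.
(* q(t) = psi((lform b + t X_i)^(r+1) P); its linear coefficient is r + 1 times
   the value sought. *)
pose q := \poly_(k < r.+2) (psi (lform b ^+ (r.+1 - k) * 'X_i ^+ k * P) *+ 'C(r.+1, k)).
have q0 : q = 0.
  apply: poly_fun_eq0 => t.
  rewrite -(H (fun k => b k + t * (k == i)%:R)).
  have -> : lform (fun k => b k + t * (k == i)%:R) = lform b + t *: 'X_i.
    rewrite /lform; under eq_bigr do rewrite scalerDl.
    rewrite big_split /=; congr (_ + _).
    rewrite (bigD1 i) //= eqxx mulr1 big1 ?addr0 // => k /negPf ->.
    by rewrite mulr0 scale0r.
  rewrite exprDn mulr_suml linear_sum /= horner_poly.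
  apply: eq_bigr => k _.
  by rewrite exprZn -scalerAr !mulrnAl -scalerAl linearMn linearZ /= mulrC.
have /eqP := congr1 (fun q : {poly C} => q`_1) q0.
rewrite coef_poly /= coef0 bin1 mulrn_eq0 /= expr1 subSS subn0 => /eqP <-.
by rewrite mulrA.
Qed.

Lemma mulmx_entry_col (R : pzRingType) p q (x : 'rV[R]_p) (A : 'M_(p, q)) l :
  (x *m A) 0 l = (x *m col l A) 0 0.
Proof. by rewrite !mxE; apply: eq_bigr => j _; rewrite mxE. Qed.

Section Catalecticant.
Variables (C : numFieldType) (n D : nat) (psi : {scalar {mpoly C[n]}}).
Hypothesis psi_deg : forall mu, mdeg mu != D -> psi 'X_[mu] = 0.
Implicit Types (P Q R : {mpoly C[n]}) (k : nat).

(** The P that annihilate psi form the graded ideal whose quotient is the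
    Gorenstein algebra with dual socle generator psi. *)
Definition ann P := forall Q, psi (P * Q) = 0.

Lemma annM P Q : ann P -> ann (Q * P).
Proof. by move=> aP T; rewrite mulrAC mulrC; apply: aP. Qed.

Lemma annD P Q : ann P -> ann Q -> ann (P + Q).
Proof. by move=> aP aQ T; rewrite mulrDl linearD /= aP aQ addr0. Qed.

Lemma annB P Q : ann P -> ann Q -> ann (P - Q).
Proof. by move=> aP aQ T; rewrite mulrBl linearB /= aP aQ subr0. Qed.

Lemma psi_homog k P : P \is k.-homog -> k != D -> psi P = 0.
Proof.
move=> /dhomogP hP kD; rewrite [P]mpolyE linear_sum big_seq big1 // => mu /hP dmu.
by rewrite linearZ /= psi_deg ?dmu // mulr0.
Qed.

Lemma annPm P : (forall mu, psi (P * 'X_[mu]) = 0) -> ann P.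
Proof.
move=> H Q; rewrite [Q]mpolyE mulr_sumr linear_sum big1 // => mu _.
by rewrite -scalerAr linearZ /= H mulr0.
Qed.

Lemma ann_homog k P : (k <= D)%N -> P \is k.-homog ->
  (forall mu, mdeg mu = (D - k)%N -> psi (P * 'X_[mu]) = 0) -> ann P.
Proof.
move=> kD hP H; apply: annPm => mu; have [/H//|dmu] := eqVneq (mdeg mu) (D - k)%N.
apply: (@psi_homog (k + mdeg mu)); first by apply: dhomogM => //; rewrite dhomogX.
by apply: contra dmu => /eqP <-; rewrite addKn.
Qed.

Notation N k := #|{: 'X_{1..n < k.+1}}|.
Definition bounded_mnm k (j : 'I_(N k)) : 'X_{1..n} := enum_val j.

Arguments bounded_mnm : clear implicits.

Lemma bounded_mnmP k mu : (mdeg mu <= k)%N -> exists j : 'I_(N k), bounded_mnm k j = mu.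
Proof.
move=> dmu; exists (enum_rank (@BMultinom n k.+1 mu dmu)).
by rewrite /bounded_mnm enum_rankK.
Qed.

Lemma bounded_mnm_inj k : injective (bounded_mnm k).
Proof. by move=> i j /val_inj/enum_val_inj. Qed.

(** Rows of coefficients are indexed by all monomials of degree at most k, because
    they form a finite type; the sum keeps those of degree k. *)
Definition form_of_row k (u : 'rV[C]_(N k)) : {mpoly C[n]} :=
  \sum_(j | mdeg (bounded_mnm k j) == k) u 0 j *: 'X_[bounded_mnm k j].

Arguments form_of_row : clear implicits.

Lemma form_of_row_is_linear k : linear (form_of_row k).
Proof.
move=> a u v; rewrite /form_of_row scaler_sumr -big_split /=; apply: eq_bigr => j _.
by rewrite !mxE scalerDl scalerA.
Qed.
HB.instance Definition _ k :=
  GRing.isLinear.Build _ _ _ _ (form_of_row k) (@form_of_row_is_linear k).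

Lemma form_of_row_homog k u : form_of_row k u \is k.-homog.
Proof. by apply: rpred_sum => j dj; apply: rpredZ; rewrite dhomogX. Qed.

Lemma form_of_row_surj k P : P \is k.-homog -> exists u, P = form_of_row k u.
Proof.
move=> /dhomogP hP; exists (\row_(j < N k) P@_(bounded_mnm k j)).
rewrite /form_of_row; apply/mpolyP => mu; rewrite raddf_sum /=.
under eq_bigr do rewrite mxE mcoeffZ mcoeffX.
have [/eqP dmu|dmu] := eqVneq (mdeg mu) k.
  have [j jmu] := bounded_mnmP (eq_leq (eqP dmu)).
  rewrite (bigD1 j) ?jmu //= eqxx mulr1 big1 ?addr0 // => l /andP[_ lj].
  by rewrite -jmu (inj_eq (@bounded_mnm_inj k)) (negPf lj) mulr0.
rewrite memN_msupp_eq0; last by apply: contra dmu => /hP ->.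
rewrite big1 // => j /eqP dj; case: eqP => [e|]; last by rewrite mulr0.
by rewrite -e dj eqxx in dmu.
Qed.

(** The functional psi(P * _) in coordinates: a faithful model of the class of P in
    the Gorenstein algebra of psi, because psi vanishes above degree D. *)
Definition contraction P : 'rV[C]_(N D) := \row_j psi (P * 'X_[bounded_mnm D j]).

Lemma contraction_is_linear : linear contraction.
Proof.
move=> a P Q; apply/rowP => j.
by rewrite !mxE mulrDl -scalerAl linearP.
Qed.
HB.instance Definition _ :=
  GRing.isLinear.Build _ _ _ _ contraction contraction_is_linear.

Lemma contraction_eq0 P : contraction P = 0 <-> ann P.
Proof.
split=> [H|H]; last by apply/rowP => j; rewrite !mxE H.
apply: annPm => mu; have [dmu|dmu] := leqP (mdeg mu) D.
  by have [j <-] := bounded_mnmP dmu; move/rowP/(_ j): H; rewrite !mxE.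
rewrite [P]mpolyE mulr_suml linear_sum big1 // => nu _.
rewrite -scalerAl linearZ /= -mpolyXD psi_deg ?mulr0 // mdegD.
by apply: contraTneq dmu => <-; rewrite -leqNgt leq_addl.
Qed.

(** The row space is the degree k part of that algebra multiplied by Q; for
    Q = 1 this is the catalecticant matrix of psi. *)
Definition catmx Q k : 'M[C]_(N k, N D) :=
  \matrix_j contraction (Q * form_of_row k (delta_mx 0 j)).

Lemma mul_catmx Q k u : u *m catmx Q k = contraction (Q * form_of_row k u).
Proof.
rewrite mulmx_sum_row [in RHS](row_sum_delta u) !linear_sum mulr_sumr linear_sum.
by apply: eq_bigr => j _; rewrite rowK !linearZ /= -scalerAr linearZ.
Qed.

Lemma catmx_linear Q Q' t k : catmx (Q + t *: Q') k = (catmx Q k + t *: catmx Q' k)%R.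
Proof.
apply/row_matrixP => j; rewrite !rowK linearD linearZ /= !rowK.
by rewrite mulrDl -scalerAl linearD linearZ.
Qed.

Lemma sub_catmxP Q k x :
  reflect (exists2 P, P \is k.-homog & x = contraction (Q * P)) (x <= catmx Q k)%MS.
Proof.
apply: (iffP submxP) => [[u ->]|[P /form_of_row_surj[u ->] ->]].
  by exists (form_of_row k u); rewrite ?form_of_row_homog // mul_catmx.
by exists u; rewrite mul_catmx.
Qed.

Lemma ker_catmxS Q R k : (kermx (catmx Q k) <= kermx (catmx (R * Q) k))%MS.
Proof.
apply/rV_subP => u /sub_kermxP; rewrite mul_catmx => /contraction_eq0 H.
by apply/sub_kermxP; rewrite mul_catmx -mulrA; apply/contraction_eq0/annM.
Qed.

Lemma rank_catmxM Q R k : (\rank (catmx (R * Q) k) <= \rank (catmx Q k))%N.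
Proof.
have := mxrankS (ker_catmxS Q R k); rewrite !mxrank_ker.
have := rank_leq_row (catmx Q k); have := rank_leq_row (catmx (R * Q) k); lia.
Qed.

Lemma rank_catmxM_lt Q R k P : P \is k.-homog -> ~ ann (Q * P) -> ann (R * Q * P) ->
  (\rank (catmx (R * Q) k) < \rank (catmx Q k))%N.
Proof.
move=> /form_of_row_surj[u ->] naP aP.
have : (\rank (kermx (catmx Q k)) < \rank (kermx (catmx (R * Q) k)))%N.
  apply: rank_ltmx; rewrite ltmxE ker_catmxS /=; apply/negP => S; apply: naP.
  have : (u <= kermx (catmx (R * Q) k))%MS.
    by apply/sub_kermxP; rewrite mul_catmx; apply/contraction_eq0.
  by move/submx_trans/(_ S)/sub_kermxP; rewrite mul_catmx => /contraction_eq0.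
rewrite !mxrank_ker.
have := rank_leq_row (catmx Q k); have := rank_leq_row (catmx (R * Q) k); lia.
Qed.

Definition injective_on (Q : {mpoly C[n]}) k :=
  forall P, P \is k.-homog -> ann (Q * P) -> ann P.

(** If a linear form a of maximal rank has a kernel vector w, then w deforms to
    kernel vectors of a + t b for every b.  Comparing coefficients puts b^j w in the
    image of a^j, so these images lose a dimension at each step up to degree D,
    which takes more than D - k dimensions. *)
Lemma generic_injective k : (k <= D)%N -> (\rank (catmx 1 k) <= D - k)%N ->
  exists a, injective_on (lform a) k.
Proof.
move=> kD rk.
(* A linear form of maximal rank in degree k. *)
have [a maxa] : exists a, forall b,
    (\rank (catmx (lform b) k) <= \rank (catmx (lform a) k))%N.
  pose p r := `[< exists b, \rank (catmx (lform b) k) = r >].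
  have exp : exists r, p r.
    by exists (\rank (catmx (lform (fun=> 0)) k)); apply/asboolP; exists (fun=> 0).
  have ubp r : p r -> (r <= N k)%N by move=> /asboolP[b <-]; apply: rank_leq_row.
  case: (ex_maxnP exp ubp) => r /asboolP[a <-] maxr; exists a => b.
  by apply: maxr; apply/asboolP; exists b.
exists a => P hP aP; apply: (ann_homog kD hP) => mu dmu; rewrite mulrC.
apply: (powers_span _ dmu) => b; apply/eqP/negPn/negP => nz.
have [u Pu] := form_of_row_surj hP.
have [||w w0 wS] := @kernel_deformation _ _ _ (catmx (lform a) k) (catmx (lform b) k) u.
- move=> t; rewrite -catmx_linear.
  have -> : lform a + t *: lform b = lform (fun i => a i + t * b i).
    rewrite /lform scaler_sumr -big_split; apply: eq_bigr => i _ /=.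
    by rewrite scalerDl scalerA.
  exact: maxa.
- by rewrite mul_catmx -Pu; apply/contraction_eq0.
(* Up to sign, b^j P = a^j w_j modulo the annihilator. *)
have chain j : ann (lform a ^+ j * form_of_row k (w j) - (-1) ^+ j * (lform b ^+ j * P)).
  elim: j => [|j IH].
    by rewrite !expr0 !mul1r w0 -Pu subrr => Q; rewrite mul0r linear0.
  have step : ann (lform a * form_of_row k (w j.+1) + lform b * form_of_row k (w j)).
    by apply/contraction_eq0; rewrite linearD /= -!mul_catmx wS addNr.
  have := annB (annM (lform a ^+ j) step) (annM (lform b) IH).
  by congr ann; rewrite !exprS; ring.
(* So a^j times the degree k part contains b^j P, which a kills and which is not
   zero because b^(D - k) P is not: multiplying by a once more loses rank. *)
have drop j : (j <= (D - k).+1)%N ->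
    (\rank (catmx (lform a ^+ j) k) + j <= \rank (catmx 1 k))%N.
  elim: j => [|j IH] jD; first by rewrite addn0.
  rewrite addnS; apply: leq_trans (IH (ltnW jD)); rewrite ltn_add2r exprS.
  apply: (rank_catmxM_lt (@form_of_row_homog k (w j))).
    move=> /annB/(_ (chain j)); rewrite opprB addrCA subrr addr0 => /(annM ((-1) ^+ j)).
    rewrite mulrA -exprD addnn -mul2n exprM sqrrN !expr1n mul1r.
    move=> /(annM (lform b ^+ (D - k - j))); rewrite mulrA -exprD subnK //.
    by move=> /(_ 1); rewrite mulr1; apply/eqP.
  have := annD (annM (lform a) (chain j)) (annM ((-1) ^+ j * lform b ^+ j) aP).
  by congr ann; ring.
suff : (D - k < \rank (catmx 1 k))%N by rewrite ltnNge rk.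
by apply: leq_trans (drop _ (leqnn _)); rewrite leq_addl.
Qed.

Definition spans_next a k :=
  forall P, P \is k.+1.-homog -> (contraction P <= catmx (lform a) k)%MS.

(** Duality of the Gorenstein algebra: a form of degree k'.+1 outside the image of
    multiplication by lform a would be separated from that image by pairing with
    some Z of degree k, and Z would be killed by lform a. *)
Lemma injective_spans a k k' : (k + k'.+1)%N = D ->
  injective_on (lform a) k -> spans_next a k'.
Proof.
move=> kk' inj P hP; rewrite submxE; apply/eqP/rowP => l; rewrite [RHS]mxE.
set A := catmx _ _; pose z := col l (cokermx A).
have Az : A *m z = 0 by rewrite /z colE mulmxA mulmx_coker mul0mx.
have -> : (contraction P *m cokermx A) 0 l = (contraction P *m z) 0 0.
  exact: mulmx_entry_col.
pose Z := \sum_(j | mdeg (bounded_mnm D j) == k) z j 0 *: 'X_[bounded_mnm D j].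
have hZ : Z \is k.-homog by apply: rpred_sum => j dj; apply: rpredZ; rewrite dhomogX.
have zE Q : Q \is k'.+1.-homog -> (contraction Q *m z) 0 0 = psi (Q * Z).
  move=> hQ; rewrite mxE /Z mulr_sumr linear_sum.
  rewrite (bigID (fun j => mdeg (bounded_mnm D j) == k)) /=.
  rewrite [X in _ + X]big1 ?addr0 => [|j dj].
    by apply: eq_bigr => j _; rewrite mxE -scalerAr linearZ /= mulrC.
  rewrite mxE (@psi_homog (k'.+1 + mdeg (bounded_mnm D j))) ?mul0r //.
    by apply: dhomogM => //; rewrite dhomogX.
  by apply: contra dj => /eqP e; apply/eqP; lia.
rewrite zE // mulrC; apply: inj => //.
apply: (@ann_homog (1 + k)); first by lia.
  by apply: dhomogM => //; apply: lform_homog.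
move=> mu dmu; rewrite mulrAC -zE; last first.
  have -> : k'.+1 = (1 + mdeg mu)%N by lia.
  by apply: dhomogM; rewrite ?lform_homog // dhomogX.
have /submxP[y ->] : (contraction (lform a * 'X_[mu]) <= A)%MS.
  by apply/sub_catmxP; exists 'X_[mu] => //; rewrite dhomogX /= dmu; apply/eqP; lia.
by rewrite -mulmxA Az mulmx0 mxE.
Qed.

Lemma ann_eq P Q R :
  contraction P = contraction Q -> contraction (R * P) = contraction (R * Q).
Proof.
move=> e; apply/eqP; rewrite -subr_eq0 -linearB -mulrBr.
apply/eqP/contraction_eq0/annM/contraction_eq0.
by rewrite linearB /= e subrr.
Qed.

(** Forms of degree k.+2 are combinations of the variables times forms of degree
    k.+1, and multiplication by a variable commutes with that by lform a. *)
Lemma spans_nextS a k : spans_next a k -> spans_next a k.+1.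
Proof.
move=> sp P /dhomogP hP; rewrite [P]mpolyE linear_sum big_seq.
apply: summx_sub => mu /hP /= /mnm_pred[i [nu [-> dnu]]].
rewrite linearZ /=; apply: scalemx_sub; rewrite mpolyXD.
have /sub_catmxP[Q hQ eQ] : (contraction 'X_[nu] <= catmx (lform a) k)%MS.
  by apply: sp; rewrite dhomogX /= dnu.
apply/sub_catmxP; exists ('X_i * Q); last by rewrite mulrCA; apply: ann_eq.
exact: homog_mulX.
Qed.

Lemma spans_rank a k : spans_next a k ->
  (\rank (catmx 1 k.+1) <= \rank (catmx 1 k))%N.
Proof.
move=> sp; apply: leq_trans (mxrankS _) (rank_catmxM 1 (lform a) k).
rewrite mulr1; apply/row_subP => j; rewrite rowK mul1r.
by apply: sp; apply: form_of_row_homog.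
Qed.

(** If lform a kills P then it kills all the 'X_i * P, and an element below the
    socle degree annihilated by all variables is zero. *)
Lemma injective_onW a k : (k < D)%N ->
  injective_on (lform a) k.+1 -> injective_on (lform a) k.
Proof.
move=> kD inj P hP aP; apply: (ann_homog (ltnW kD) hP) => mu.
rewrite -(subnSK kD) => /mnm_pred[i [nu [-> dnu]]].
rewrite mpolyXD mulrA (mulrC P); apply: inj; last by rewrite mulrCA; apply: annM.
exact: homog_mulX.
Qed.

End Catalecticant.

Arguments bounded_mnm {n} k j.
Arguments form_of_row {C n} k u.

(** * A common zero of the annihilator *)

Section CommonZero.
Variables (C : numClosedFieldType) (n D : nat) (psi : {scalar {mpoly C[n]}}).
Hypothesis psi_deg : forall mu, mdeg mu != D -> psi 'X_[mu] = 0.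
Variables (a : 'I_n -> C) (k : nat).
Notation La := (lform a).
Notation contraction := (contraction D psi).
Notation catmx := (catmx D psi).
Notation ann := (ann psi).
Hypothesis inj0 : injective_on psi La k.
Hypothesis inj1 : injective_on psi La k.+1.
Hypothesis sp0 : spans_next D psi a k.
Hypothesis rk_gt0 : (0 < \rank (catmx 1 k))%N.

(** When multiplication by La identifies the degrees k, k.+1 and k.+2, the
    quotients of the variables by La act on the degree k part as commuting
    matrices.  A common eigenvector gives the coordinates of a point p, and the
    corresponding functional on degree k.+2 is a nonzero multiple of evaluation
    at p; it vanishes on the annihilator. *)
Lemma common_zero : exists2 p : 'I_n -> C, (exists i, p i != 0) &
  forall F, F \is k.+2.-homog -> ann F -> F.@[p] = 0.
Proof.
move: rk_gt0; set s := \rank (catmx 1 k) => s_gt0.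
have /submxP[U BU] : (row_base (catmx 1 k) <= catmx 1 k)%MS by rewrite eq_row_base.
rewrite -/s in U BU.
pose e (y : 'rV_s) := form_of_row k (y *m U).
have he y : e y \is k.-homog by apply: form_of_row_homog.
have [b mul_b b1] : exists2 b : {mpoly C[n]} -> 'M[C]_(s, _),
    forall y Q, y *m b Q = contraction (Q * e y) & b 1 = row_base (catmx 1 k).
  by exists (fun Q => U *m catmx Q k) => // y Q; rewrite mulmxA mul_catmx.
have free0 : row_free (b 1) by rewrite b1 row_base_free.
have e0 y : ann (e y) -> y = 0.
  move=> /(contraction_eq0 psi_deg) ay; apply: (row_free_inj free0).
  by rewrite mul_b mul1r mul0mx.
have free2 : row_free (b (La * La)).
  apply: inj_row_free => y; rewrite mul_b -mulrA => /(contraction_eq0 psi_deg) ay.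
  apply/e0/inj0 => //; apply: inj1 => //.
  exact: homog_mul_lform.
have bP P : P \is k.+1.-homog -> exists y, contraction P = contraction (La * e y).
  move=> /sp0/sub_catmxP[Q hQ ->].
  have : (contraction Q <= row_base (catmx 1 k))%MS.
    by rewrite eq_row_base; apply/sub_catmxP; exists Q => //; rewrite mul1r.
  rewrite -b1 => /submxP[y]; rewrite mul_b mul1r => eQ.
  by exists y; apply: ann_eq.
(* Y i is multiplication by X_i followed by division by La, in degree k. *)
have [Y YE] : exists Y, forall i, Y i *m b La = b 'X_i.
  exists (fun i => b 'X_i *m pinvmx (b La)) => i.
  apply: mulmxKpV; apply/row_subP => j; rewrite rowE mul_b.
  have [|y ->] := bP ('X_i * e (delta_mx 0 j)).
    exact: homog_mulX.
  by rewrite -mul_b submxMl.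
have YM i R : Y i *m b (R * La) = b (R * 'X_i).
  apply/row_matrixP => j; rewrite !rowE mulmxA !mul_b -!mulrA; apply: ann_eq => //.
  by rewrite -!mul_b -YE mulmxA.
have YC i j : Y i *m Y j = Y j *m Y i.
  apply: (row_free_inj free2); rewrite -(mulmxA (Y i)) -(mulmxA (Y j)) !YM.
  by rewrite (mulrC La 'X_j) (mulrC La 'X_i) !YM mulrC.
have [v v0 /allP stab] : exists2 v : 'rV_s, v != 0 &
    all (fun A => stablemx v A) [seq (Y i)^T | i : 'I_n].
  apply: common_eigenvector => // _ _ /mapP[i _ ->] /mapP[j _ ->].
  by rewrite /comm_mx -!trmx_mul YC.
have [p vY] : exists p, forall i, Y i *m v^T = p i *: v^T.
  exists (fun i => (v *m (Y i)^T *m pinvmx v) 0 0) => i.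
  have /stab vi : (Y i)^T \in [seq (Y i)^T | i : 'I_n] by apply: map_f; rewrite mem_enum.
  apply: trmx_inj; rewrite trmx_mul trmxK linearZ /= trmxK.
  by rewrite -mul_scalar_mx -mx11_scalar mulmxKpV.
(* z extends the eigenvector v, seen as a functional on degree k, to degree k + 2
   through multiplication by La^2. *)
have [z bz] : exists z, forall y, contraction (La * La * e y) *m z = y *m v^T.
  exists (pinvmx (b (La * La)) *m v^T) => y.
  by rewrite -mul_b mulmxA -(mulmxA y) mulmxVp // mulmx1.
pose L P := (contraction P *m z) 0 0.
have LX i P : P \is k.+1.-homog -> L ('X_i * P) = p i * L (La * P).
  move=> /bP[y ey]; rewrite /L (ann_eq psi_deg _ ey) (ann_eq psi_deg La ey).
  rewrite (mulrA 'X_i) (mulrC 'X_i) -mul_b -YM mulmxA mul_b bz mulrA bz.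
  by rewrite -mulmxA vY -scalemxAr mxE.
have L_lin c P Q : L (c *: P + Q) = c * L P + L Q.
  by rewrite /L linearP mulmxDl -scalemxAl !mxE.
have L0 : L 0 = 0 by rewrite /L linear0 mul0mx mxE.
have L_sum (I : Type) (r : seq I) (c : I -> C) (F : I -> {mpoly C[n]}) :
    L (\sum_(i <- r) c i *: F i) = \sum_(i <- r) c i * L (F i).
  by elim: r => [|i r IH]; rewrite ?big_nil // !big_cons L_lin IH.
have LXM d mu j : mdeg mu = d -> (d + j)%N = k.+2 ->
    L ('X_[mu] * La ^+ j) = 'X_[mu].@[p] * L (La ^+ k.+2).
  elim: d mu j => [|d IH] mu j.
    move=> /eqP; rewrite mdeg_eq0 => /eqP -> <-.
    by rewrite mpolyX0 meval1 !mul1r.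
  move=> /mnm_pred[i [nu [-> dnu]]] dj.
  rewrite mpolyXD -mulrA LX; last first.
    have -> : k.+1 = (d + 1 * j)%N by lia.
    apply: dhomogM; first by rewrite dhomogX /= dnu.
    exact/dhomogMn/lform_homog.
  rewrite mulrCA -exprS IH ?addnS // mevalM mevalXU mulrA //.
have LF F : F \is k.+2.-homog -> L F = F.@[p] * L (La ^+ k.+2).
  move=> /dhomogP hF; rewrite {1}[F]mpolyE L_sum [in RHS](mpolyE F).
  rewrite raddf_sum mulr_suml /= big_seq [RHS]big_seq.
  apply: eq_bigr => mu /hF dmu; rewrite mevalZ -mulrA; congr (_ * _).
  by rewrite -(LXM _ _ 0%N dmu) ?addn0 // expr0 mulr1.
have [j vj] : exists j, v 0 j != 0 by apply/rV0Pn.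
pose y : 'rV[C]_s := delta_mx 0 j.
have Ly : L (La * (La * e y)) != 0.
  by rewrite /L mulrA bz -rowE !mxE.
have hy : La * e y \is k.+1.-homog by apply: homog_mul_lform.
have Lk : L (La ^+ k.+2) != 0.
  apply: contraNneq Ly => L0'; rewrite LF ?L0' ?mulr0 //.
  exact: homog_mul_lform.
exists p; last first.
  move=> F hF /(contraction_eq0 psi_deg) aF; have := LF F hF.
  rewrite {1}/L aF mul0mx mxE => /esym/eqP.
  by rewrite mulf_eq0 (negPf Lk) orbF => /eqP.
apply/existsP; rewrite -negb_forall; apply/negP => /forallP p0.
move: Ly; rewrite {1}/lform mulr_suml.
under eq_bigr do rewrite -scalerAl.
rewrite L_sum big1 ?eqxx // => i _.
by rewrite LX // (eqP (p0 i)) mul0r mulr0.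
Qed.
End CommonZero.

(** * The rank of the middle catalecticant *)

(** With fewer than m dimensions in the middle degree, generic_injective applies in
    degree m; the dual surjectivity bounds the dimension in degree m.+1, where it
    applies again, and common_zero then contradicts the absence of a common
    zero. *)
Lemma catalecticant_rank (C : numClosedFieldType) n m (psi : {scalar {mpoly C[n]}}) :
    (2 <= m)%N -> (forall mu, mdeg mu != m.*2 -> psi 'X_[mu] = 0) ->
    (exists mu, psi 'X_[mu] != 0) ->
    (forall p : 'I_n -> C, (exists i, p i != 0) ->
      exists F, [/\ F \is m.+2.-homog, ann psi F & F.@[p] != 0]) ->
  (m <= \rank (catmx m.*2 psi 1 m))%N.
Proof.
move=> m2 psi_deg [mu0 nz] nozero.
rewrite leqNgt; apply/negP => rk.
have [||a0 inj0] := @generic_injective _ _ _ psi psi_deg m _ _; [lia|lia|].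
have sp0 : spans_next m.*2 psi a0 m.
  have sp : spans_next m.*2 psi a0 m.-1.
    by apply: (injective_spans psi_deg _ inj0); lia.
  by have := spans_nextS psi_deg sp; rewrite prednK //; lia.
have rk1 := spans_rank psi_deg sp0.
have [||a inj1] := @generic_injective _ _ _ psi psi_deg m.+1 _ _; [lia|lia|].
(* Injectivity in degree m + 1 is dual to surjectivity from degree m - 2 to m - 1. *)
have spa : spans_next m.*2 psi a m.-1.
  have sp : spans_next m.*2 psi a m.-2.
    by apply: (injective_spans psi_deg _ inj1); lia.
  by have := spans_nextS psi_deg sp; rewrite prednK //; lia.
have spa0 : spans_next m.*2 psi a m.
  by have := spans_nextS psi_deg spa; rewrite prednK //; lia.
have inja : injective_on psi (lform a) m.
  by apply: (injective_onW psi_deg) inj1; lia.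
have rk_gt0 : (0 < \rank (catmx m.*2 psi 1 m))%N.
  rewrite lt0n mxrank_eq0; apply: contraNneq nz => cat0.
  have low mu j : mdeg mu = (m + j)%N -> ann psi 'X_[mu].
    elim: j mu => [|j IH] mu; rewrite ?addn0 ?addnS.
      move=> dmu; apply/(contraction_eq0 psi_deg).
      have : (contraction m.*2 psi 'X_[mu] <= catmx m.*2 psi 1 m)%MS.
        by apply/sub_catmxP; exists 'X_[mu]; rewrite ?mul1r // dhomogX /= dmu.
      by rewrite cat0 => /submx0null.
    by move=> /mnm_pred[i [nu [-> /IH aX]]]; rewrite mpolyXD; apply: annM.
  have [dmu|/psi_deg -> //] := eqVneq (mdeg mu0) m.*2.
  rewrite -addnn in dmu; apply/eqP.
  by have := low _ _ dmu 1; rewrite mulr1.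
have [p p0 H] := common_zero psi_deg inja inj1 spa0 rk_gt0.
by have [F [hF aF]] := nozero p p0; rewrite (H F hF aF) eqxx.
Qed.

Lemma independent_forms (C : numFieldType) n D m r (psi : {scalar {mpoly C[n]}}) :
    (r <= \rank (catmx D psi 1 m))%N ->
  exists2 g : 'I_r -> {mpoly C[n]}, forall k, g k \is m.-homog &
    forall c : 'I_r -> C, ann psi (\sum_k c k *: g k) -> forall k, c k = 0.
Proof.
move=> rk; set B := row_base (catmx D psi 1 m).
have /submxP[U BU] : (B <= catmx D psi 1 m)%MS by rewrite eq_row_base.
pose w (k : 'I_r) := widen_ord rk k.
exists (fun k => form_of_row m (row (w k) U)) => [k|c ac l]; first exact: form_of_row_homog.
pose y := \sum_k c k *: delta_mx 0 (w k) : 'rV[C]_(\rank (catmx D psi 1 m)).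
suff /rowP/(_ (w l)) : y = 0.
  rewrite summxE (bigD1 l) //= !mxE !eqxx mulr1 big1 ?addr0 // => k kl.
  rewrite !mxE /=; case: eqP => [|_]; last by rewrite mulr0.
  by move=> [/val_inj e]; rewrite e eqxx in kl.
apply: (row_free_inj (row_base_free (catmx D psi 1 m))).
rewrite mul0mx -/B BU mulmxA mul_catmx mul1r.
have -> : form_of_row m (y *m U) = \sum_k c k *: form_of_row m (row (w k) U).
  rewrite mulmx_suml linear_sum; apply: eq_bigr => k _.
  by rewrite -scalemxAl -rowE linearZ.
by apply/rowP => j; rewrite !mxE ac.
Qed.

(** * The Nullstellensatz in two variables *)

Definition in_ideal (R : pzRingType) (I : finType) (p : I -> R) (q : R) :=
  exists h : I -> R, q = \sum_i h i * p i.

Lemma in_ideal_gen (R : pzRingType) (I : finType) (p : I -> R) i : in_ideal p (p i).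
Proof.
exists (fun j => (j == i)%:R); rewrite (bigD1 i) //= eqxx mul1r big1 ?addr0 //.
by move=> j /negPf ->; rewrite mul0r.
Qed.

Lemma in_idealD (R : pzRingType) (I : finType) (p : I -> R) q r :
  in_ideal p q -> in_ideal p r -> in_ideal p (q + r).
Proof.
move=> [h ->] [k ->]; exists (fun i => h i + k i).
by rewrite -big_split; apply: eq_bigr => i _; rewrite mulrDl.
Qed.

Lemma in_idealM (R : pzRingType) (I : finType) (p : I -> R) a q :
  in_ideal p q -> in_ideal p (a * q).
Proof.
move=> [h ->]; exists (fun i => a * h i).
by rewrite mulr_sumr; apply: eq_bigr => i _; rewrite mulrA.
Qed.

(** A nonzero element of least degree in the ideal divides every member up to a
    power of its leading coefficient, by pseudo-division. *)
Lemma pseudo_generator (R : idomainType) (I : finType) (p : I -> {poly R}) i0 :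
  p i0 != 0 -> exists g, [/\ g != 0, in_ideal p g &
    forall i, exists k q, lead_coef g ^+ k *: p i = q * g].
Proof.
move=> pi0.
pose P n := `[< exists g, [/\ g != 0, in_ideal p g & size g = n] >].
have exP : exists n, P n.
  by exists (size (p i0)); apply/asboolP; exists (p i0); split=> //; exact: in_ideal_gen.
case: (ex_minnP exP) => n /asboolP[g [g0 gI <-]] ming; exists g; split=> // i.
exists (scalp (p i) g), (p i %/ g); rewrite Pdiv.Idomain.divp_eq.
suff -> : p i %% g = 0 by rewrite addr0.
apply/eqP/negPn/negP => r0.
suff /asboolP/ming : exists r, [/\ r != 0, in_ideal p r & size r = size (p i %% g)].
  by rewrite leqNgt ltn_modp g0.
exists (p i %% g); split=> //.
have -> : p i %% g = (lead_coef g ^+ scalp (p i) g)%:P * p i + - (p i %/ g) * g.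
  by rewrite mul_polyC Pdiv.Idomain.divp_eq mulNr addrC addKr.
by apply: in_idealD; apply: in_idealM => //; apply: in_ideal_gen.
Qed.

Lemma univariate_bezout (C : closedFieldType) (I : finType) (p : I -> {poly C}) :
  (forall x, exists i, (p i).[x] != 0) -> in_ideal p 1.
Proof.
move=> nz.
have [i0 pi0] : exists i, p i != 0.
  by have [i pi] := nz 0; exists i; apply: contraNneq pi => ->; rewrite horner0.
have [g [g0 gI gdiv]] := pseudo_generator pi0.
have [/size_poly1P[c c0 gc]|/closed_rootP[x gx]] := boolP (size g == 1%N).
  have := in_idealM c^-1%:P gI; rewrite gc -polyCM mulVf //.
have [j] := nz x; have [k [q /(congr1 (fun p => p.[x]))]] := gdiv j.
rewrite hornerM (rootP gx) mulr0 hornerZ => /eqP.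
by rewrite mulf_eq0 expf_eq0 lead_coef_eq0 (negPf g0) andbF /= => ->.
Qed.

Local Notation fibre y := (map_poly (horner_eval y)).

Lemma fibreE (C : comNzRingType) (x y : C) (p : {poly {poly C}}) :
  (fibre y p).[x] = p.[x%:P].[y].
Proof.
have := horner_map (horner_eval y) p x%:P.
by rewrite /= /horner_eval hornerC.
Qed.

Lemma fibre_eq0 (C : fieldType) (y : C) (p : {poly {poly C}}) : fibre y p = 0 ->
  exists r, p = ('X - y%:P)%:P * r.
Proof.
move=> p0; exists (map_poly (fun c => c %/ ('X - y%:P)) p).
apply/polyP => k; rewrite coefCM coef_map_id0 ?div0p // mulrC divpK //.
rewrite dvdp_XsubCl; apply/rootP.
by have := congr1 (fun q : {poly C} => q`_k) p0; rewrite coef_map coef0.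
Qed.

(** Pseudo-division in the outer variable first produces a nonzero e in the ideal
    that depends on the inner variable alone: otherwise the pseudo-generator has
    a root above almost every point of the line.  Roots of e are then removed one
    at a time, by Bezout's identity in the fibre over the root. *)
Lemma bivariate_nullstellensatz (C : numClosedFieldType) (I : finType)
    (p : I -> {poly {poly C}}) :
  (forall x y, exists i, (p i).[x%:P].[y] != 0) -> in_ideal p 1.
Proof.
move=> nz.
have [i0 pi0] : exists i, p i != 0.
  have [i pi] := nz 0 0; exists i; apply: contraNneq pi => ->.
  by rewrite !horner0.
(* e is a pseudo-generator, constant in the outer variable. *)
have [e e0 eI] : exists2 e : {poly C}, e != 0 & in_ideal p e%:P.
  have [g [g0 gI gdiv]] := pseudo_generator pi0.
  have [/size_poly1P[c c0 gc]|sg] := boolP (size g == 1%N).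
    by exists c; rewrite // -gc.
  have [y ly] : exists y, (lead_coef g).[y] != 0.
    apply: contrapT => /forallNP H; move: g0; rewrite -lead_coef_eq0 => /eqP; apply.
    by apply: poly_fun_eq0 => y; apply/eqP/negPn/negP/H.
  have /closed_rootP[x gx] : size (fibre y g) != 1%N by rewrite size_map_poly_id0.
  have [j] := nz x y; have [k [q /(congr1 (fibre y))]] := gdiv j.
  move/(congr1 (fun p => p.[x])).
  rewrite -mul_polyC !rmorphM !hornerM (rootP gx) mulr0 !fibreE hornerC => /eqP.
  by rewrite mulf_eq0 horner_exp expf_eq0 (negPf ly) andbF /= => ->.
have [n] := ubnP (size e); elim: n e e0 eI => // n IH e e0 eI se.
have [/size_poly1P[c c0 ec]|/closed_rootP[y ey]] := boolP (size e == 1%N).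
  by have := in_idealM c^-1%:P%:P eI; rewrite ec -!polyCM mulVf.
have [e' ee'] : exists e', e = ('X - y%:P) * e'.
  by have /dvdpP[e'] : 'X - y%:P %| e; [rewrite dvdp_XsubCl|exists e'; rewrite mulrC].
have [u uE] : in_ideal (fun i => fibre y (p i)) 1.
  by apply: univariate_bezout => x; have [j] := nz x y; exists j; rewrite fibreE.
(* Lifting Bezout's identity from the fibre leaves an error divisible by Y - y. *)
have [r rE] : exists r, \sum_i map_poly polyC (u i) * p i - 1 = ('X - y%:P)%:P * r.
  apply: (@fibre_eq0 _ y); rewrite rmorphB rmorph1 rmorph_sum uE.
  apply/eqP; rewrite subr_eq0; apply/eqP; apply: eq_bigr => i _.
  rewrite rmorphM; congr (_ * _).
  by apply/polyP => k; rewrite !coef_map /= /horner_eval hornerC.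
apply: (IH e').
- by apply: contraNneq e0 => e'0; rewrite ee' e'0 mulr0.
- have -> : e'%:P = e'%:P * (\sum_i map_poly polyC (u i) * p i) + - r * e%:P.
    rewrite ee' polyCM; have -> : \sum_i map_poly polyC (u i) * p i = ('X - y%:P)%:P * r
        + 1.
      by rewrite -rE subrK.
    by rewrite /=; ring.
  by apply: in_idealD; apply: in_idealM => //; exists (fun i => map_poly polyC (u i)).
- rewrite ltnS in se; apply: leq_trans se; rewrite ee' size_proper_mul.
    by rewrite size_XsubC.
  rewrite lead_coefXsubC mul1r lead_coef_eq0; apply: contraNneq e0 => e'0.
  by rewrite ee' e'0 mulr0.
Qed.

(** * Homogeneous fractions with monomial denominators *)

HB.instance Definition _ (R : realType) :=
  GRing.RMorphism.copy (@toK R) (@FracField.tofrac {mpoly R[i][3]}).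

Section Localization.
Variable R : realType.
Local Notation S := {mpoly R[i][3]}.
Local Notation K := (ratK R).
Implicit Types (I J L : {set 'I_3}) (n : int) (q : K) (g : S).

Lemma toK_eq0 g : (toK g == 0) = (g == 0).
Proof. exact: tofrac_eq0. Qed.

Lemma toK_inj : injective (@toK R).
Proof.
by move=> p q e; apply/eqP; rewrite -subr_eq0 -toK_eq0 rmorphB /= e subrr.
Qed.

Definition mnm_set I : 'X_{1..3} := (\sum_(i in I) U_(i))%MM.

Lemma mnm_setE I i : mnm_set I i = (i \in I) :> nat.
Proof.
rewrite /mnm_set mnm_sumE; under eq_bigr do rewrite mnm1E.
have [iI|iI] := boolP (i \in I).
  by rewrite (bigD1 i) //= eqxx big1 // => j /andP[_ /negPf ->].
by rewrite big1 // => j jI; case: eqP => // ji; rewrite -ji jI in iI.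
Qed.

Lemma mdeg_mnm_set I : mdeg (mnm_set I) = #|I|.
Proof.
rewrite /mnm_set mdeg_sum; under eq_bigr do rewrite mdeg1.
by rewrite sum1_card.
Qed.

Lemma prodXE I : \prod_(i in I) 'X_i = 'X_[mnm_set I] :> S.
Proof. by rewrite /mnm_set mprodXE. Qed.

Definition xmon (m : 'X_{1..3}) : K := toK 'X_[m].

Lemma xmonD a b : xmon (a + b)%MM = xmon a * xmon b.
Proof. by rewrite /xmon mpolyXD rmorphM. Qed.

Lemma xmon_neq0 a : xmon a != 0.
Proof.
rewrite toK_eq0; apply/eqP => /(congr1 (mcoeff a)).
by rewrite mcoeffX eqxx mcoeff0 => /eqP; rewrite oner_eq0.
Qed.

Lemma locP I n q : loc I n q <-> exists k m g, [/\ g \is m.-homog,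
  m%:Z = n + (k * #|I|)%:Z & q = toK g / xmon (mnm_set I *+ k)].
Proof.
split=> -[k [m [g [hg dm ->]]]]; exists k, m, g; split=> //.
  by rewrite prodXE -rmorphXn mpolyXn.
by rewrite prodXE -rmorphXn mpolyXn.
Qed.

(** Used to bring several fractions to the same exponent. *)
Lemma loc_large I n q : loc I n q -> exists k0, forall k, (k0 <= k)%N ->
  exists m g, [/\ g \is m.-homog, m%:Z = n + (k * #|I|)%:Z &
                  q = toK g / xmon (mnm_set I *+ k)].
Proof.
move=> /locP[k0 [m [g [hg dm ->]]]]; exists k0 => k kk0.
exists (m + #|I| * (k - k0))%N, (g * 'X_[mnm_set I *+ (k - k0)]); split.
- apply: dhomogM hg _; rewrite dhomogX /= mdegMn mdeg_mnm_set //.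
- rewrite PoszD dm -addrA -PoszD; congr (_ + _%:Z).
  by rewrite -(subnKC kk0) addKn mulnDl (mulnC #|I|).
have -> : (mnm_set I *+ k = mnm_set I *+ k0 + mnm_set I *+ (k - k0))%MM.
  by apply/mnmP => i; rewrite mnmDE !mulmnE -mulnDr subnKC.
by rewrite xmonD rmorphM /= -/(xmon _) invfM mulrACA divff ?mulr1 ?xmon_neq0.
Qed.

Lemma locM I n n' q q' : loc I n q -> loc I n' q' -> loc I (n + n') (q * q').
Proof.
move=> /locP[k [m [g [hg dm ->]]]] /locP[k' [m' [g' [hg' dm' ->]]]].
apply/locP; exists (k + k')%N, (m + m')%N, (g * g'); split.
- exact: dhomogM.
- by rewrite PoszD dm dm' mulnDl PoszD addrACA.
have -> : (mnm_set I *+ (k + k') = mnm_set I *+ k + mnm_set I *+ k')%MM.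
  by apply/mnmP => i; rewrite mnmDE !mulmnE mulnDr.
by rewrite xmonD rmorphM /= invfM mulrACA.
Qed.

Lemma locD I n q q' : loc I n q -> loc I n q' -> loc I n (q + q').
Proof.
move=> /loc_large[k0 H] /loc_large[k1 H'].
have [|m [g [hg dm ->]]] := H (maxn k0 k1); first exact: leq_maxl.
have [|m' [g' [hg' dm' ->]]] := H' (maxn k0 k1); first exact: leq_maxr.
apply/locP; exists (maxn k0 k1), m, (g + g'); split=> //.
  have mm' : m' = m by apply/eqP; rewrite -eqz_nat dm dm'.
  by apply: rpredD => //; rewrite -mm'.
by rewrite rmorphD mulrDl.
Qed.

Lemma loc_poly I m g : g \is m.-homog -> loc I m (toK g).
Proof.
move=> hg; apply/locP; exists 0%N, m, g; split=> //; first by rewrite mul0n addr0.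
by rewrite mulm0n /xmon mpolyX0 rmorph1 divr1.
Qed.

Lemma loc_const I (c : R[i]) : loc I 0 (constK c).
Proof. by apply: (@loc_poly I 0); rewrite -[c%:MP]mulr1 mul_mpolyC;
    apply/rpredZ/dhomog1. Qed.

Lemma locN I n q : loc I n q -> loc I n (- q).
Proof.
move=> H; rewrite -mulN1r -[n]add0r; apply: locM => //.
by rewrite -(rmorphN1 (@toK R)) -mpolyC1 -mpolyCN; apply: loc_const.
Qed.

Lemma locB I n q q' : loc I n q -> loc I n q' -> loc I n (q - q').
Proof. by move=> H H'; apply/locD/locN. Qed.

Lemma loc0 I n : (0 < #|I|)%N \/ 0 <= n -> loc I n (0 : K).
Proof.
move=> H; apply/locP.
have [k kn] : exists k, 0 <= n + (k * #|I|)%:Z by case: H => H; exists (absz n); nia.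
exists k, (absz (n + (k * #|I|)%:Z)), 0; split; first exact: rpred0.
  by rewrite gez0_abs.
by rewrite rmorph0 mul0r.
Qed.

Lemma loc_sum (A : Type) (r : seq A) (P : pred A) (F : A -> K) I n :
    (0 < #|I|)%N \/ 0 <= n ->
  (forall a, P a -> loc I n (F a)) -> loc I n (\sum_(a <- r | P a) F a).
Proof.
move=> H HF; elim/big_ind: _ => //; first exact: loc0.
by move=> x y; apply: locD.
Qed.

(** A denominator is cancelled at the indices where the exponent of the monomial
    is large enough. *)
Lemma loc_xmon n I J k mu : J \subset I ->
    (mdeg mu)%:Z = n + (k * #|I|)%:Z ->
    (forall i, i \in I :\: J -> k <= mu i)%N ->
  loc J n (xmon mu / xmon (mnm_set I *+ k)).
Proof.
move=> JI dmu le_mu; apply/locP.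
have lem : (mnm_set (I :\: J) *+ k <= mu)%MM.
  apply/mnm_lepP => i; rewrite mulmnE mnm_setE; case: (boolP (i \in _)) => [/le_mu|_].
    by rewrite mul1n.
  by rewrite mul0n.
have IE : (mnm_set I *+ k = mnm_set (I :\: J) *+ k + mnm_set J *+ k)%MM.
  apply/mnmP => i; rewrite mnmDE !mulmnE -mulnDl !mnm_setE inE; congr (_ * _)%N.
  by have := subsetP JI i; do 2!case: (_ \in _) => //; move=> /(_ isT).
exists k, (mdeg (mu - mnm_set (I :\: J) *+ k)), 'X_[mu - mnm_set (I :\: J) *+ k]; split.
- by rewrite dhomogX.
- move: dmu; rewrite -{1}(submK lem) mdegD mdegMn mdeg_mnm_set.
  have := cardsID J I; rewrite (setIidPr JI); nia.
by rewrite -{1}(submK lem) IE addmC !xmonD invfM mulrACA divff ?mul1r ?xmon_neq0.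
Qed.

Lemma toK_mpolyE g : toK g = \sum_(m <- msupp g) constK g@_m * xmon m.
Proof.
rewrite {1}[g]mpolyE rmorph_sum; apply: eq_bigr => m _.
by rewrite -mul_mpolyC rmorphM.
Qed.

Lemma loc_sub I J n q : I \subset J -> loc I n q -> loc J n q.
Proof.
move=> IJ /locP[k [m [g [hg dm ->]]]].
have JE : (mnm_set J *+ k = mnm_set I *+ k + mnm_set (J :\: I) *+ k)%MM.
  apply/mnmP => i; rewrite mnmDE !mulmnE -mulnDl !mnm_setE inE; congr (_ * _)%N.
  by have := subsetP IJ i; do 2!case: (_ \in _) => //; move=> /(_ isT).
apply/locP; exists k, (m + k * #|J :\: I|)%N, (g * 'X_[mnm_set (J :\: I) *+ k]); split.
- by apply: dhomogM hg _; rewrite dhomogX /= mdegMn mdeg_mnm_set mulnC.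
- rewrite PoszD dm; have := cardsID I J; rewrite (setIidPr IJ); nia.
by rewrite JE xmonD rmorphM /= -/(xmon _) invfM mulrACA divff ?mulr1 ?xmon_neq0.
Qed.

Lemma locXV I i : i \in I -> loc I (-1) (xK R i)^-1.
Proof.
move=> iI; apply: (@loc_sub [set i]); first by rewrite sub1set.
apply/locP; exists 1%N, 0%N, 1; split; first exact: dhomog1.
  by rewrite cards1.
by rewrite mulm1n rmorph1 mul1r /mnm_set big_set1.
Qed.

Lemma locX I i : loc I 1 (xK R i).
Proof. by apply: (@loc_poly I 1); rewrite dhomogX /= mdeg1. Qed.

Lemma supp_mulX g m nu : (g * 'X_[m])@_nu != 0 -> (m <= nu)%MM.
Proof.
rewrite -mcoeff_msupp (perm_mem (msuppMX _ _)) => /mapP[mu _ ->].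
exact: lem_addr.
Qed.

(** A polynomial identity between the two fractions shows that the variables outside
    the intersection divide the numerator, monomial by monomial.  The side
    condition excludes 0 in negative degree with empty denominator, where no
    natural number is the degree of the numerator. *)
Lemma loc_cap I J n q : (0 < #|I :&: J|)%N \/ 0 <= n ->
  loc I n q -> loc J n q -> loc (I :&: J) n q.
Proof.
move=> ne /loc_large[k0 H] /loc_large[k1 H'].
have [|m [g [hg dm qE]]] := H (maxn k0 k1); first exact: leq_maxl.
have [|m' [g' [hg' dm' qE']]] := H' (maxn k0 k1); first exact: leq_maxr.
move: (maxn k0 k1) => k in m g hg dm qE m' g' hg' dm' qE'.
have gg' : g * 'X_[mnm_set J *+ k] = g' * 'X_[mnm_set I *+ k].
  apply: toK_inj; rewrite !rmorphM; apply/eqP.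
  by rewrite -eqr_div ?xmon_neq0 // -qE -qE'.
rewrite qE toK_mpolyE mulr_suml big_seq; apply: loc_sum => // mu mug.
rewrite -mulrA -[n]add0r; apply/locM/loc_xmon; first exact: loc_const.
- exact: subsetIl.
- by rewrite -dm (dhomog_mf hg).
move=> i; rewrite !inE => /andP[niJ iI]; rewrite iI /= in niJ.
have : (mnm_set I *+ k <= mu + mnm_set J *+ k)%MM.
  by apply: (@supp_mulX g'); rewrite -gg' addmC mcoeffMX -mcoeff_msupp.
move=> /mnm_lepP/(_ i); rewrite mnmDE !mulmnE !mnm_setE iI (negPf niJ).
by rewrite mul1n mul0n addn0.
Qed.

(** Each monomial of the numerator cancels the denominator at some index of L.  For
    L = I this reads off from coefficients whether a class vanishes in the top Cech
    cohomology of the opens in I. *)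
Lemma loc_split I L n k m g :
    L \subset I -> (1 < #|I|)%N -> g \is m.-homog -> m%:Z = n + (k * #|I|)%:Z ->
    (forall mu : 'X_{1..3}, (forall i, i \in L -> mu i < k)%N -> g@_mu = 0) ->
  exists2 b : 'I_3 -> K, forall i, i \in L -> loc (I :\ i) n (b i) &
    toK g / xmon (mnm_set I *+ k) = \sum_(i in L) b i.
Proof.
move=> LI I1 hg dm g0.
(* The index of L to which a monomial is attributed. *)
pose pk (mu : 'X_{1..3}) := [pick i in L | k <= mu i]%N.
pose t (mu : 'X_{1..3}) := constK g@_mu * (xmon mu / xmon (mnm_set I *+ k)).
pose b i := \sum_(mu <- msupp g) (if pk mu == Some i then t mu else 0).
exists b => [i iL|].
  have ne : (0 < #|I :\ i|)%N \/ 0 <= n.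
    by left; have := cardsD1 i I; rewrite (subsetP LI) //; lia.
  rewrite /b big_seq; apply: loc_sum => // mu mug.
  case: eqP => [|_]; last exact: loc0.
  rewrite /pk; case: pickP => // j /andP[jL kj] [ji].
  rewrite {}ji in jL kj; rewrite /t -[n]add0r; apply/locM/loc_xmon.
  - exact: loc_const.
  - exact: subsetDl.
  - by rewrite -dm (dhomog_mf hg).
  by move=> l; rewrite !inE negb_and negbK => /andP[/orP[/eqP->|/negPf->]].
rewrite toK_mpolyE mulr_suml /b [RHS]exchange_big /= big_seq [RHS]big_seq.
apply: eq_bigr => mu mug; rewrite -mulrA -/(t mu) /pk.
case: pickP => [i /andP[iL _]|none].
  rewrite (bigD1 i) //= eqxx big1 ?addr0 // => j /andP[_ ji].
  by case: eqP => // -[ij]; rewrite ij eqxx in ji.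
rewrite /t g0 => [|i iL]; last by have := none i; rewrite iL ltnNge /= => ->.
by rewrite /constK mpolyC0 rmorph0 !mul0r big1.
Qed.

(** Converse of loc_split: after clearing denominators, every monomial of the i-th
    summand has a large exponent at i. *)
Lemma loc_sum_coef I L n N (b : 'I_3 -> K) g : L \subset I ->
    (forall i, loc (setT :\ i) n (b i)) ->
    toK g / xmon (mnm_set I *+ N) = \sum_(i in L) b i ->
  forall mu : 'X_{1..3}, (forall i, i \in L -> mu i < N)%N -> g@_mu = 0.
Proof.
move=> LI hb gE mu mu_lt.
have [k0 [c cE]] : exists k0, exists c : 'I_3 -> S,
    forall i, b i = toK (c i * 'X_[U_(i) *+ k0]) / xmon (mnm_set setT *+ k0).
  pose P i k0 := forall k, (k0 <= k)%N -> exists m c, [/\ c \is m.-homog,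
    m%:Z = n + (k * #|setT :\ i|)%:Z & b i = toK c / xmon (mnm_set (setT :\ i) *+ k)].
  have /choice[f fP] : forall i, exists k0, P i k0 by move=> i; apply: loc_large.
  pose k0 := (\max_i f i)%N; exists k0.
  suff /choice[c cE] : forall i, exists c,
      b i = toK (c * 'X_[U_(i) *+ k0]) / xmon (mnm_set setT *+ k0) by exists c.
  move=> i; have [|m' [c [_ _ ->]]] := fP i k0; first exact: leq_bigmax.
  exists c; have -> : (mnm_set setT *+ k0 = mnm_set (setT :\ i) *+ k0 + U_(i) *+ k0)%MM.
    apply/mnmP => j; rewrite mnmDE !mulmnE -mulnDl !mnm_setE mnm1E !inE eq_sym andbT.
    by case: eqP.
  by rewrite xmonD rmorphM /= -/(xmon _) invfM mulrACA divff ?mulr1 ?xmon_neq0.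
have gE' : g * 'X_[mnm_set setT *+ k0] =
    \sum_(i in L) c i * 'X_[U_(i) *+ k0 + mnm_set I *+ N].
  apply: toK_inj; rewrite rmorphM rmorph_sum /=.
  have -> : toK g = (\sum_(i in L) b i) * xmon (mnm_set I *+ N).
    by rewrite -gE divfK ?xmon_neq0.
  rewrite !mulr_suml; apply: eq_bigr => i _; rewrite cE mpolyXD mulrA !rmorphM /=.
  by rewrite mulrAC divfK // xmon_neq0.
have := congr1 (mcoeff (mnm_set setT *+ k0 + mu)%MM) gE'.
rewrite mcoeffMX raddf_sum /= big1 // => i iL.
apply/eqP/negPn/negP => /supp_mulX/mnm_lepP/(_ i).
rewrite !mnmDE !mulmnE mnm1E !mnm_setE (subsetP LI) // inE eqxx !mul1n.
by have := mu_lt i iL; lia.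
Qed.
End Localization.

(** * Cech cohomology of the plane and local duality *)

Notation o0 := (@Ordinal 3 0 isT).
Notation o1 := (@Ordinal 3 1 isT).
Notation o2 := (@Ordinal 3 2 isT).

Lemma I3P (P : 'I_3 -> Prop) : P o0 -> P o1 -> P o2 -> forall i, P i.
Proof.
move=> P0 P1 P2 [[|[|[|//]]] i3].
- by rewrite (_ : Ordinal i3 = o0) //; apply: val_inj.
- by rewrite (_ : Ordinal i3 = o1) //; apply: val_inj.
- by rewrite (_ : Ordinal i3 = o2) //; apply: val_inj.
Qed.

Lemma sum3 (V : nmodType) (F : 'I_3 -> V) : \sum_i F i = F o0 + F o1 + F o2.
Proof.
rewrite !big_ord_recl big_ord0 addr0 addrA.
by congr (F _ + F _ + F _); apply: val_inj.
Qed.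

Section Vectors.
Variable K : comPzRingType.
Implicit Types u v w : 'I_3 -> K.

Definition dot u v := \sum_i u i * v i.

Definition cross u v (i : 'I_3) : K :=
  match val i with
  | 0 => u o1 * v o2 - u o2 * v o1
  | 1 => u o2 * v o0 - u o0 * v o2
  | _ => u o0 * v o1 - u o1 * v o0
  end.

(** As a triple product; expanding along the rows gives the usual determinant. *)
Definition det3 u v w := dot u (cross v w).

Lemma cross_cross u v w i : cross (cross u v) w i = dot u w * v i - dot v w * u i.
Proof. by rewrite /dot !sum3; elim/I3P: i; rewrite /cross /=; ring. Qed.

Lemma det3_expand u v w x i : det3 u v w * x i =
  dot w x * cross u v i + dot u x * cross v w i + dot v x * cross w u i.
Proof. by rewrite /det3 /dot !sum3; elim/I3P: i; rewrite /cross /=; ring. Qed.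

Lemma crossC u v i : cross u v i = - cross v u i.
Proof. by elim/I3P: i; rewrite /cross /=; ring. Qed.

Lemma cross_shift p q u v w i :
  cross (fun j => p * u j - q * v j + w j) v i = p * cross u v i + cross w v i.
Proof. by elim/I3P: i; rewrite /cross /=; ring. Qed.

Lemma dot_cross u v : dot (cross u v) v = 0.
Proof. by rewrite /dot sum3 /cross /=; ring. Qed.

Lemma dotBl u v w : dot (fun i => u i - v i) w = dot u w - dot v w.
Proof. by rewrite /dot -sumrB; apply: eq_bigr => i _; rewrite mulrBl. Qed.

Lemma dotZl c u w : dot (fun i => c * u i) w = c * dot u w.
Proof. by rewrite /dot mulr_sumr; apply: eq_bigr => i _; rewrite mulrA. Qed.
End Vectors.

Section Cohomology.
Variable R : realType.
Local Notation S := {mpoly R[i][3]}.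
Local Notation K := (ratK R).
Implicit Types (I J L : {set 'I_3}) (n : int) (q : K) (g : S).

Lemma card_pair (i j : 'I_3) : i != j -> #|[set i; j]| = 2%N.
Proof. by move=> ij; rewrite cards2 ij. Qed.

Lemma card_setTD1 (i : 'I_3) : #|setT :\ i| = 2%N.
Proof. by have := cardsD1 i [set: 'I_3]; rewrite cardsT card_ord inE => -[]. Qed.

(** The vanishing of H^1(P^2, O(n)).  The cocycle condition writes c01 as a sum of
    fractions without x_0, respectively without x_1, in the denominator; by
    loc_split the two can be chosen without x_2 as well, and gluing does the
    rest. *)
Lemma cocycle01 n (c01 c12 c02 : K) :
    loc [set o0; o1] n c01 -> loc [set o1; o2] n c12 -> loc [set o0; o2] n c02 ->
    c01 + c12 = c02 ->
  exists2 s : 'I_3 -> K, forall a, loc [set a] n (s a) &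
    [/\ c01 = s o1 - s o0, c12 = s o2 - s o1 & c02 = s o2 - s o0].
Proof.
move=> h01 h12 h02 cE.
have T0 : setT :\ o0 = [set o1; o2] by apply/setP; apply: I3P; rewrite !inE.
have T1 : setT :\ o1 = [set o0; o2] by apply/setP; apply: I3P; rewrite !inE.
have D0 : [set o0; o1] :\ o0 = [set o1] by apply/setP; apply: I3P; rewrite !inE.
have D1 : [set o0; o1] :\ o1 = [set o0] by apply/setP; apply: I3P; rewrite !inE.
have C2 : [set o0; o2] :&: [set o1; o2] = [set o2].
  by apply/setP; apply: I3P; rewrite !inE.
have sum01 (F : 'I_3 -> K) : \sum_(i in [set o0; o1]) F i = F o0 + F o1.
  by rewrite big_setU1 ?inE //= big_set1.
have /locP[k [m [g [hg dm c01E]]]] := h01.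
pose c i := if i == o0 then - c12 else if i == o1 then c02 else 0.
have g0 (mu : 'X_{1..3}) : (forall i, i \in [set o0; o1] -> mu i < k)%N -> g@_mu = 0.
  apply: (@loc_sum_coef _ [set o0; o1] _ n k c).
  - exact: subxx.
  - apply: I3P; rewrite /c /=; first by rewrite T0; apply: locN.
      by rewrite T1.
    by apply: loc0; left; rewrite card_setTD1.
  by rewrite sum01 /c /= -c01E -cE addrC addrK.
have [b hb c01b] := loc_split (subxx _) (eq_leq (esym (card_pair (isT : o0 != o1)))) hg
    dm g0.
rewrite -c01E sum01 in c01b.
have := hb o0; rewrite D0 !inE => /(_ isT) hb0.
have := hb o1; rewrite D1 !inE => /(_ isT) hb1.
have h2 : loc [set o2] n (c02 - b o1).
  rewrite -C2; apply: loc_cap.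
  - by left; rewrite C2 cards1.
  - by apply: locB h02 _; apply: loc_sub hb1; apply: subsetUl.
  have -> : c02 - b o1 = c12 + b o0 by rewrite -cE c01b; ring.
  by apply: locD h12 _; apply: loc_sub hb0; apply: subsetUl.
exists (fun i => if i == o0 then - b o1 else if i == o1 then b o0 else c02 - b o1).
  by apply: I3P => //=; apply: locN.
rewrite /=; split; rewrite -?cE c01b; ring.
Qed.

Lemma locMe I n1 n2 n q q' : n1 + n2 = n ->
  loc I n1 q -> loc I n2 q' -> loc I n (q * q').
Proof. by move=> <-; apply: locM. Qed.

Lemma loc_singleton I n q a : a \in I -> loc [set a] n q -> loc I n q.
Proof. by move=> aI; apply: loc_sub; rewrite sub1set. Qed.

Lemma loc0n0 I n q : loc set0 n q -> loc I n q.
Proof. by apply: loc_sub; apply: sub0set. Qed.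

Lemma loc_cross I n1 n2 n (u v : 'I_3 -> K) : n1 + n2 = n ->
  (forall i, loc I n1 (u i)) -> (forall i, loc I n2 (v i)) ->
  forall i, loc I n (cross u v i).
Proof.
move=> nE hu hv.
have uv i j : loc I n (u i * v j) by apply: locMe nE _ _.
by apply: I3P; rewrite /cross /=; apply: locB.
Qed.

Lemma loc_dot I n1 n2 n (u v : 'I_3 -> K) : n1 + n2 = n ->
  (forall i, loc I n1 (u i)) -> (forall i, loc I n2 (v i)) -> loc I n (dot u v).
Proof.
move=> nE hu hv; rewrite /dot sum3.
have uv i : loc I n (u i * v i) by apply: locMe nE _ _.
by apply: locD; first apply: locD.
Qed.

Lemma loc_det3 I n1 n (u v w : 'I_3 -> K) : n1 *+ 3 = n ->
  (forall i, loc I n1 (u i)) -> (forall i, loc I n1 (v i)) ->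
  (forall i, loc I n1 (w i)) -> loc I n (det3 u v w).
Proof.
move=> nE hu hv hw; apply: (loc_dot (n1 := n1) (n2 := n1 *+ 2)) => //.
by apply: loc_cross.
Qed.

Lemma mderiv_homog d g i : g \is d.-homog -> g^`M(i) \is d.-1.-homog.
Proof.
move=> hg; apply/dhomogP => mu; rewrite mcoeff_msupp mcoeff_deriv mulrn_eq0 /=.
by rewrite -mcoeff_msupp => /(dhomog_mf hg); rewrite mfD /= mdeg1 addn1 => <-.
Qed.

Lemma mderiv_euler d g : g \is d.-homog -> \sum_i 'X_i * g^`M(i) = d%:R * g.
Proof.
move=> hg.
have eulerX i mu : 'X_i * ('X_[mu] : S)^`M(i) = (mu i)%:R *: 'X_[mu].
  rewrite mderivX -scalerAr -mpolyXD; have [->|mui] := eqVneq (mu i) 0%N.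
    by rewrite !scale0r.
  by rewrite addmC submK // lep1mP.
transitivity (\sum_(mu <- msupp g) \sum_i g@_mu *: ('X_i * ('X_[mu] : S)^`M(i))).
  rewrite exchange_big /=; apply: eq_bigr => i _.
  rewrite {1}[g]mpolyE linear_sum mulr_sumr; apply: eq_bigr => mu _.
  by rewrite linearZ /= scalerAr.
rewrite {3}[g]mpolyE mulr_sumr big_seq [RHS]big_seq.
apply: eq_bigr => mu /(dhomog_mf hg) /= <-.
under eq_bigr do rewrite eulerX scalerA.
rewrite -scaler_suml -mulr_sumr -natr_sum -mdegE mulrC -scalerA.
by rewrite scaler_nat mulr_natl.
Qed.

Lemma euler d g : g \is d.-homog -> dot (xK R) (dfK g) = d%:R * toK g.
Proof.
move=> /mderiv_euler/(congr1 (@toK R)).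
by rewrite rmorph_sum rmorphM rmorph_nat => <-; apply: eq_bigr => i _; rewrite rmorphM.
Qed.

Section Chase.
Variables (d : nat) (f : S) (alpha : 'I_3 -> 'I_3 -> K).
Hypothesis d_gt0 : (0 < d)%N.
Hypothesis hf : f \is d.-homog.
Hypothesis alpha_loc : forall a i, loc [set a] (1 - d%:Z) (alpha a i).
Hypothesis alpha_df : forall a, dot (alpha a) (dfK f) = 1.
Local Notation df := (dfK f).
Local Notation det := (det3 (alpha o0) (alpha o1) (alpha o2)).

Lemma loc_df I i : loc I (d%:Z - 1) (df i).
Proof.
have -> : d%:Z - 1 = d.-1%:Z by lia.
by apply/loc_poly/mderiv_homog.
Qed.

Lemma det_df i : det * df i = cross (alpha o0) (alpha o1) i +
   cross (alpha o1) (alpha o2) i + cross (alpha o2) (alpha o0) i.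
Proof. by rewrite det3_expand !alpha_df !mul1r. Qed.

Lemma cross_alpha_df a b i :
  cross (cross (alpha a) (alpha b)) df i = alpha b i - alpha a i.
Proof. by rewrite cross_cross !alpha_df !mul1r. Qed.

(** P det is the image of the class of P under the connecting maps of the Koszul
    complex of df, which is exact on the charts.  If it is a coboundary, the Koszul
    cochains can be corrected step by step until the local solutions P alpha^a of
    u . df = P agree on overlaps and give a global one. *)
Lemma local_duality n P (b : 'I_3 -> K) : 0 <= n + 1 - d%:Z -> loc set0 n P ->
    (forall i, loc (setT :\ i) (n + (1 - d%:Z) *+ 3) (b i)) ->
    P * det = \sum_i b i ->
  exists2 u : 'I_3 -> K, forall i, loc set0 (n + 1 - d%:Z) (u i) & P = dot u df.
Proof.
move=> n0 hP hb; rewrite sum3 => Pdet.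
pose cr a b i := P * cross (alpha a) (alpha b) i.
set n2 := n + (1 - d%:Z) *+ 2.
have hcr a e i : loc [set a; e] n2 (cr a e i).
  apply: (@locMe _ n ((1 - d%:Z) *+ 2)) => //; first exact: loc0n0.
  by apply: loc_cross => // j;
      [apply: (@loc_singleton _ _ _ a)|apply: (@loc_singleton _ _ _ e)];
    rewrite ?inE ?eqxx ?orbT.
have hbd (i l a e : 'I_3) : setT :\ i = [set a; e] -> loc [set a; e] n2 (b i * df l).
  move=> <-; apply: locMe (hb i) (loc_df _ l); rewrite /n2; ring.
have /choice[s sE] : forall i, exists s : 'I_3 -> K, (forall a, loc [set a] n2 (s a)) /\
   [/\ cr o0 o1 i - b o2 * df i = s o1 - s o0,
      cr o1 o2 i - b o0 * df i = s o2 - s o1 &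
      cr o0 o2 i + b o1 * df i = s o2 - s o0].
  move=> i; have [||||s hs sE] := @cocycle01 n2 (cr o0 o1 i - b o2 * df i)
    (cr o1 o2 i - b o0 * df i) (cr o0 o2 i + b o1 * df i).
  - by apply: locB => //; apply: hbd; apply/setP; apply: I3P; rewrite !inE.
  - by apply: locB => //; apply: hbd; apply/setP; apply: I3P; rewrite !inE.
  - by apply: locD => //; apply: hbd; apply/setP; apply: I3P; rewrite !inE.
  - have E : P * (det * df i) = (b o0 + b o1 + b o2) * df i by rewrite mulrA Pdet.
    rewrite det_df in E; apply/subr0_eq; rewrite /cr (crossC (alpha o0) (alpha o2)).
    by rewrite -[RHS](subrr ((b o0 + b o1 + b o2) * df i)) -{1}E; ring.
  by exists s.
(* The corrected cochain is the coboundary of del, which repairs the local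
   solutions. *)
pose del a i := s i a.
pose u a i := P * alpha a i - cross (del a) df i.
have hu a i : loc [set a] (n + 1 - d%:Z) (u a i).
  apply: locB.
    by apply: locMe (loc0n0 _ hP) (alpha_loc a i); ring.
  apply: (loc_cross (n1 := n2) (n2 := d%:Z - 1)) => [|j|j]; last exact: loc_df.
    by rewrite /n2; ring.
  by have [+ _] := sE j; apply.
have u01 i : u o0 i = u o1 i.
  have -> : u o1 i = P * alpha o1 i -
      cross (fun j => P * cross (alpha o0) (alpha o1) j - b o2 * df j + del o0 j) df i.
    rewrite /u; congr (_ - cross _ _ _); apply/funext => j.
    by have [_ [-> _ _]] := sE j; rewrite /del subrK.
  by rewrite cross_shift cross_alpha_df /u; ring.
exists (u o0) => [i|].
  have -> : set0 = [set o0] :&: [set o1] by apply/setP; apply: I3P; rewrite !inE.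
  by apply: loc_cap => //; [right|rewrite u01].
by rewrite dotBl dotZl alpha_df mulr1 dot_cross subr0.
Qed.
End Chase.
End Cohomology.

(** * The residue functional of a smooth curve *)

(** For G over a power of x_0 x_1 x_2 with suitable m, this is the Grothendieck
    residue of Q times that fraction. *)
Definition residue (C : nzRingType) n (G : {mpoly C[n]})
    (m : 'X_{1..n}) (Q : {mpoly C[n]}) : C :=
  (G * Q)@_m.

Lemma residue_is_scalar (C : comNzRingType) n (G : {mpoly C[n]}) m :
  scalar (residue G m).
Proof.
by move=> a P Q; rewrite /residue mulrDr -scalerAr mcoeffD mcoeffZ.
Qed.
HB.instance Definition _ (C : comNzRingType) n (G : {mpoly C[n]}) m :=
  GRing.isLinear.Build _ _ _ _ (residue G m) (@residue_is_scalar C n G m).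

(** On the curve this is smoothness; off the curve it follows from Euler's identity. *)
Lemma gradient_neq0 (R : realType) d (f : {mpoly R[i][3]}) (p : 'I_3 -> R[i]) : (0 < d)%N ->
  smooth_plane_curve d f -> (exists i, p i != 0) -> exists i, (f^`M(i)).@[p] != 0.
Proof.
move=> d0 [hf sm] p0; have [fp|fp] := eqVneq f.@[p] 0; first exact: sm.
apply: contrapT => /forallNP H; move: fp; apply/negP/negPn.
have := congr1 (meval p) (mderiv_euler hf).
rewrite raddf_sum /= big1 => [|i _]; last first.
  by rewrite mevalM (_ : (f^`M(i)).@[p] = 0) ?mulr0 //; apply/eqP/negPn/negP/H.
rewrite mevalM -mpolyC_nat mevalC => /esym/eqP; rewrite mulf_eq0 pnatr_eq0.
by case: eqP d0 => // ->.
Qed.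

Lemma smooth_neq0 (R : realType) d (f : {mpoly R[i][3]}) :
  (0 < d)%N -> smooth_plane_curve d f -> f != 0.
Proof.
move=> d0 smf; have [|i] := gradient_neq0 (p := fun=> 1) d0 smf.
  by exists o0; apply: oner_neq0.
by apply: contraNneq => ->; rewrite raddf0 meval0.
Qed.

Section Residue.
Variable R : realType.
Local Notation S := {mpoly R[i][3]}.
Local Notation K := (ratK R).

(** The zero classes of H^2(P^2, O(n)), computed on the three coordinate opens. *)
Definition cech_trivial (q : K) := exists n b,
  (forall i, loc (setT :\ i) n (b i)) /\ q = \sum_i b i.

Lemma cech_trivial_mono q mu : cech_trivial q -> cech_trivial (q * xmon R mu).
Proof.
move=> [n [b [hb ->]]]; exists (n + (mdeg mu)%:Z), (fun i => b i * xmon R mu).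
split=> [i|]; last by rewrite mulr_suml.
by apply: locM => //; apply: loc_poly; rewrite dhomogX.
Qed.

Lemma residue_trivial G N Q : 
  cech_trivial (toK (G * Q) / xmon R (mnm_set setT *+ N.+1)) ->
  residue G (mnm_set setT *+ N) Q = 0.
Proof.
move=> [n [b [hb GQ]]]; apply: (loc_sum_coef (subxx setT) hb (N := N.+1)).
  by rewrite GQ; apply: eq_bigl => i; rewrite inE.
by move=> i _; rewrite mulmnE mnm_setE inE mul1n.
Qed.

Variables (d : nat) (f : S) (alpha : 'I_3 -> 'I_3 -> K).
Hypothesis d_ge5 : (5 <= d)%N.
Hypothesis hf : f \is d.-homog.
Hypothesis alpha_loc : forall a i, loc [set a] (1 - d%:Z) (alpha a i).
Hypothesis alpha_df : forall a, dot (alpha a) (dfK f) = 1.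
Local Notation df := (dfK f).
Local Notation det := (det3 (alpha o0) (alpha o1) (alpha o2)).

Let d_gt0 : (0 < d)%N. Proof. by apply: leq_trans d_ge5. Qed.

(** By Cramer's rule det times a component of df is a sum of products of components
    of two of the three vectors alpha. *)
Lemma det_gradient_trivial n P i : loc set0 n P -> cech_trivial (P * df i * det).
Proof.
move=> hP; pose b (j : 'I_3) := match val j with
  | 0 => P * cross (alpha o1) (alpha o2) i
  | 1 => P * cross (alpha o2) (alpha o0) i
  | _ => P * cross (alpha o0) (alpha o1) i end.
have hc (j a e : 'I_3) : j != a -> j != e ->
    loc (setT :\ j) (n + (1 - d%:Z) *+ 2) (P * cross (alpha a) (alpha e) i).
  move=> ja je; apply: locM; first exact: loc0n0.
  apply: loc_cross => // l;
      [apply: (@loc_singleton _ _ _ _ a)|apply: (@loc_singleton _ _ _ _ e)] => //;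
  by rewrite !inE eq_sym ?ja ?je.
exists (n + (1 - d%:Z) *+ 2), b; split; first by apply: I3P; apply: hc.
by rewrite -mulrA (mulrC (df i)) det_df // sum3 /b /=; ring.
Qed.

Lemma det_fraction : exists N m D, [/\ D \is m.-homog,
  m%:Z = (1 - d%:Z) *+ 3 + (N.+1 * 3)%:Z &
  det = toK D / xmon R (mnm_set setT *+ N.+1)].
Proof.
have : loc setT ((1 - d%:Z) *+ 3) det.
  by apply: loc_det3 => // i; apply: loc_singleton (alpha_loc _ i).
move=> /loc_large[k H]; have [|m [D [hD dm ->]]] := H k.+1; first exact: leqnSn.
by exists k, m, D; rewrite dm cardsT card_ord.
Qed.

(** The residue functional is nonzero by local duality, kills the partial derivatives
    by Cramer's rule, and these have no common zero, so its middle catalecticant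
    has rank at least d - 3. *)
Lemma independent_products s : smooth_plane_curve d f -> s \is d.-homog ->
    ~ (exists2 u : 'I_3 -> K, forall i, loc set0 1 (u i) & toK s = dot u df) ->
  exists2 g : 'I_(d - 3) -> S, forall k, g k \is (d - 3).-homog &
    forall c : 'I_(d - 3) -> R[i],
      cech_trivial (toK ((\sum_k c k *: g k) * s) * det) -> forall k, c k = 0.
Proof.
move=> smf hs sJ; have [N [m [D [hD dm detD]]]] := det_fraction.
pose psi : {scalar S} := residue (s * D) (mnm_set setT *+ N).
have psi_ann P : cech_trivial (toK (P * s) * det) -> ann psi P.
  move=> tP; apply: annPm => mu; apply: residue_trivial.
  have := cech_trivial_mono mu tP; congr cech_trivial.
  by rewrite detD /xmon !rmorphM /=; ring.
have psi_deg mu : mdeg mu != (d - 3).*2 -> psi 'X_[mu] = 0.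
  move=> dmu; apply: (@dhomog_nemf_coeff _ _ mdeg (d + m + mdeg mu)).
    by apply: dhomogM; [apply: dhomogM|rewrite dhomogX].
  rewrite /= mdegMn mdeg_mnm_set cardsT card_ord; apply: contra dmu => /eqP e.
  by apply/eqP; lia.
(* If psi vanished, all the coefficients that obstruct loc_split would vanish. *)
have psi_nz : exists mu, psi 'X_[mu] != 0.
  apply: contrapT => /forallNP psi0; apply: sJ.
  have g0 (mu : 'X_{1..3}) : (forall i, i \in setT -> mu i < N.+1)%N -> (s * D)@_mu = 0.
    move=> mu_lt; have /negP := psi0 (mnm_set setT *+ N - mu)%MM;
        rewrite negbK /psi /= /residue.
    have le_mu : (mu <= mnm_set setT *+ N)%MM.
      by apply/mnm_lepP => i; rewrite mulmnE mnm_setE inE mul1n -ltnS mu_lt ?inE.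
    by rewrite -[X in (_ * _)@_X](submK le_mu) mcoeffMX => /eqP.
  have [||b hb sD] := loc_split (n := d%:Z + (1 - d%:Z) *+ 3) (subxx setT) _ (dhomogM hs
      hD) _ g0.
  - by rewrite cardsT card_ord.
  - by rewrite cardsT card_ord PoszD dm; ring.
  have [||||u hu su] := local_duality d_gt0 hf alpha_loc alpha_df (n := d%:Z) (P := toK
      s) (b := b).
  - lia.
  - exact: loc_poly.
  - by move=> i; apply: hb; rewrite inE.
  - rewrite detD mulrA -rmorphM sD; by apply: eq_bigl => i; rewrite inE.
  by exists u => // i; have := hu i; rewrite addrC addKr.
have d3 : (d - 3).+2 = d.-1 by lia.
have psi_df i : ann psi f^`M(i).
  by apply: psi_ann; rewrite rmorphM /= (mulrC (toK _));
      apply: (det_gradient_trivial (n := d)); apply: loc_poly.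
have rk : (d - 3 <= \rank (catmx (d - 3).*2 psi 1 (d - 3)))%N.
  apply: catalecticant_rank => //; first by lia.
  move=> p p0; have [i pi] := gradient_neq0 d_gt0 smf p0.
  by exists f^`M(i); split=> //; rewrite d3; apply: mderiv_homog.
have [g hg gI] := independent_forms rk; exists g => // c tc; apply: gI.
exact: psi_ann.
Qed.
End Residue.

(** * Inverting the gradient on the affine charts *)

Lemma rmorph_mmap n (A T U : comNzRingType) (phi : {rmorphism A -> T})
    (rho : {rmorphism T -> U}) (h : 'I_n -> T) (g : {mpoly A[n]}) :
  rho (mmap phi h g) = mmap (rho \o phi) (rho \o h) g.
Proof.
rewrite /mmap rmorph_sum; apply: eq_bigr => m _; rewrite rmorphM /=; congr (_ * _).
by rewrite /mmap1 rmorph_prod; apply: eq_bigr => i _; rewrite rmorphXn.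
Qed.

HB.instance Definition _ (R : realType) :=
  GRing.RMorphism.copy (@constK R) (@toK R \o @mpolyC 3 R[i]).

Section Affine.
Variable R : realType.
Local Notation S := {mpoly R[i][3]}.
Local Notation K := (ratK R).

Lemma loc_horner (I : {set 'I_3}) (u : K) (p : {poly K}) : (0 < #|I|)%N ->
  loc I 0 u -> (forall j, loc I 0 p`_j) -> loc I 0 p.[u].
Proof.
move=> I0 hu hp; rewrite horner_coef; apply: loc_sum; first by left.
move=> j _; apply: (locMe (n1 := 0) (n2 := 0)) => //.
elim: (j : nat) => [|k IH]; first by rewrite expr0 -(rmorph1 (@constK R)); apply: loc_const.
by rewrite exprS; apply: (locMe (n1 := 0) (n2 := 0)).
Qed.

Lemma loc_xVn (a : 'I_3) k : loc [set a] (- k%:Z) ((xK R a)^-1 ^+ k).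
Proof.
elim: k => [|k IH]; first by rewrite expr0 -(rmorph1 (@constK R)); apply: loc_const.
by rewrite exprS; apply: (locMe _ (@locXV _ _ a (set11 a)) IH); lia.
Qed.

(** On the affine chart x_a = 1 the partial derivatives have no common zero, so they
    generate the unit ideal in two variables; rehomogenizing the coefficients gives
    fractions with a power of x_a as denominator. *)
Lemma inverse_gradient d (f : S) : (0 < d)%N -> smooth_plane_curve d f ->
  exists2 alpha : 'I_3 -> 'I_3 -> K,
    forall a i, loc [set a] (1 - d%:Z) (alpha a i) &
    forall a, dot (alpha a) (dfK f) = 1.
Proof.
move=> d0 smf; have [hf _] := smf.
suff /choice[alpha H] : forall a, exists u : 'I_3 -> K,
    (forall i, loc [set a] (1 - d%:Z) (u i)) /\ dot u (dfK f) = 1.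
  by exists alpha => a; have [] := H a.
move=> a.
have [b [c [bc abc]]] : exists b c : 'I_3, [/\ b != a, c != a & c != b] /\
    forall i, [|| i == a, i == b | i == c].
  by elim/I3P: a; [exists o1, o2|exists o0, o2|exists o0, o1]; split=> //; apply: I3P.
have [ba ca cb] := bc.
(* Dehomogenization at x_a, with 'X standing for x_b and 'X%:P for x_c. *)
pose h (i : 'I_3) : {poly {poly R[i]}} :=
  if i == a then 1 else if i == b then 'X else 'X%:P.
pose D : S -> {poly {poly R[i]}} := mmap (polyC \o polyC) h.
have [u uE] : in_ideal (fun i => D f^`M(i)) 1.
  apply: bivariate_nullstellensatz => x y.
  pose ev : {rmorphism {poly {poly R[i]}} -> R[i]} := horner_eval y \o horner_eval x%:P.
  have evD g : (D g).[x%:P].[y] = g.@[ev \o h].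
    rewrite -[LHS]/(ev (D g)) (rmorph_mmap (polyC \o polyC) ev).
    apply: eq_bigr => m _; congr (_ * _).
    by rewrite /= /horner_eval !hornerC.
  have [|i fi] := gradient_neq0 (p := ev \o h) d0 smf.
    exists a; have -> : (ev \o h) a = 1 by rewrite /= /h eqxx; apply: (rmorph1 ev).
    exact: oner_neq0.
  by exists i; rewrite evD.
pose v := xK R b / xK R a; pose w := xK R c / xK R a.
pose rho1 : {rmorphism {poly R[i]} -> K} := horner_eval w \o map_poly (@constK R).
pose rho : {rmorphism {poly {poly R[i]}} -> K} := horner_eval v \o map_poly rho1.
have xa0 : xK R a != 0 by apply: xmon_neq0.
have rhoh i : rho (h i) = xK R i / xK R a.
  have := abc i; rewrite /h; have [->|ia] /= := eqVneq i a; first by move=> _;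
      rewrite divff //; apply: (rmorph1 rho).
  have [->|ib] /= := eqVneq i b; first by move=> _; rewrite horner_evalE map_polyX hornerX.
  by move=> /eqP ->; rewrite map_polyC /= !horner_evalE hornerC map_polyX hornerX.
have rhoD k g : g \is k.-homog -> rho (D g) = toK g / xK R a ^+ k.
  move=> hg; rewrite (rmorph_mmap (polyC \o polyC) rho) toK_mpolyE mulr_suml.
  rewrite /mmap big_seq [RHS]big_seq; apply: eq_bigr => m /(dhomog_mf hg) /= <-.
  rewrite -mulrA; congr (_ * _).
    by rewrite /= map_polyC /= !horner_evalE hornerC map_polyC hornerC.
  rewrite /xmon mpolyXE_id rmorph_prod mdegE /mmap1 -prodrXr -prodf_div.
  apply: eq_bigr => i _; rewrite (_ : (_ \o _) i = xK R i / xK R a); last exact: rhoh.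
  by rewrite expr_div_n rmorphXn.
have hv (i : 'I_3) : loc [set a] 0 (xK R i / xK R a).
  by apply: (locMe _ (@locX _ _ _) (@locXV _ _ a (set11 a))).
have hrho p : loc [set a] 0 (rho p).
  apply: loc_horner; rewrite ?cards1 //; first exact: hv.
  move=> j; rewrite coef_map; apply: loc_horner; rewrite ?cards1 //; first exact: hv.
  by move=> l; rewrite coef_map; apply: loc_const.
exists (fun i => rho (u i) * (xK R a)^-1 ^+ d.-1); split=> [i|].
  by apply: (locMe _ (hrho _) (loc_xVn a d.-1)); lia.
rewrite -(rmorph1 rho) uE rmorph_sum; apply: eq_bigr => i _.
rewrite rmorphM (rhoD d.-1) ?exprVn; last exact: mderiv_homog.
by rewrite -mulrA (mulrC (_ ^-1)).
Qed.
End Affine.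

(** * Deformations induced by a form of degree d *)

Section Sheaves.
Variable R : realType.
Local Notation S := {mpoly R[i][3]}.
Local Notation K := (ratK R).
Variables (d : nat) (f : S).
Implicit Types (I J : {set 'I_3}) (n : int) (q : K).

Lemma vanD n I q q' : van d f n I q -> van d f n I q' -> van d f n I (q + q').
Proof.
move=> [t [ht ->]] [t' [ht' ->]]; exists (t + t'); split; first exact: locD.
by rewrite mulrDr.
Qed.

Lemma vanN n I q : van d f n I q -> van d f n I (- q).
Proof.
by move=> [t [ht ->]]; exists (- t); split; [apply: locN|rewrite mulrN].
Qed.

Lemma vanMe n1 n2 n I q q' : n1 + n2 = n ->
  loc I n1 q -> van d f n2 I q' -> van d f n I (q * q').
Proof.
move=> <- hq [t [ht ->]]; exists (q * t); split; last by rewrite mulrCA.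
by apply: (locMe _ hq ht); ring.
Qed.

Lemma van_sub n I J q : I \subset J -> van d f n I q -> van d f n J q.
Proof. by move=> IJ [t [ht ->]]; exists t; split=> //; apply: loc_sub ht. Qed.

Lemma van_f n I q : loc I (n - d%:Z) q -> van d f n I (fK f * q).
Proof. by exists q. Qed.

Lemma van0 n I : (0 < #|I|)%N -> van d f n I 0.
Proof. by move=> I0; exists 0; split; [apply: loc0; left|rewrite mulr0]. Qed.

Lemma van_sum n I (F : 'I_3 -> K) : (0 < #|I|)%N ->
  (forall i, van d f n I (F i)) -> van d f n I (\sum_i F i).
Proof.
by move=> I0 hF; elim/big_ind: _ => //; [apply: van0|move=> x y; apply: vanD].
Qed.

Lemma loc_set0P n q : loc set0 n q -> exists m g,
  [/\ m%:Z = n, g \is m.-homog & q = @toK R g].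
Proof.
move=> /locP[k [m [g [hg dm ->]]]]; exists m, g; split=> //.
  by rewrite dm cards0 muln0 addr0.
by rewrite /mnm_set big_set0 (_ : (0 *+ k)%MM = 0%MM) ?/xmon ?mpolyX0 ?rmorph1 ?divr1 //;
  apply/mnmP => i; rewrite mulmnE mnm0E mul0n.
Qed.

(** xi is cohomologous to v b - v a with v a a local vector field of the plane that
    maps f to the global form s; the correction by a coboundary is absorbed in v. *)
Definition planar_lift (xi : 'I_3 -> 'I_3 -> 'rV[K]_3) (s : S) (v : 'I_3 -> 'rV[K]_3) :=
  [/\ forall a i, loc [set a] 1 (v a 0 i),
      forall a, van d f d [set a] (toN f (v a) - toK s) &
      forall a b, nulT d f [set a; b] (xi a b - (v b - v a))].

Lemma toND v w : toN f (v + w) = toN f v + toN f w.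
Proof. by rewrite /toN -big_split; apply: eq_bigr => i _; rewrite mxE mulrDr. Qed.

(** A section of the normal bundle is only given up to multiples of f on each chart;
    since H^1(P^2, O) = 0 these multiples can be adjusted so that the local
    expressions glue to a polynomial. *)
Lemma planar_lift_ex (xi : 'I_3 -> 'I_3 -> amb (TF d f)) :
    f \is d.-homog -> f != 0 ->
  preserves_planarity xi -> exists s v, s \is d.-homog /\ planar_lift xi s v.
Proof.
move=> hf f0 [s [v [[ss sn] vs vn [t [ts tn]]]]].
have fK0 : fK f != 0 by rewrite toK_eq0.
have [t01 [h01 e01]] := sn o0 o1.
have [t12 [h12 e12]] := sn o1 o2.
have [t02 [h02 e02]] := sn o0 o2.
have [|tau htau [E01 E12 E02]] := cocycle01 h01 h12 h02.
  by apply: (mulfI fK0); rewrite mulrDr -e01 -e12 -e02 /=; ring.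
pose s' := s o0 + fK f * tau o0.
have s'E a : s a = s' - fK f * tau a.
  elim/I3P: a; rewrite /s'; first by ring.
    by move/eqP: e01; rewrite subr_eq E01 => /eqP -> /=; ring.
  by move/eqP: e02; rewrite subr_eq E02 => /eqP -> /=; ring.
have hs' a : loc [set a] d s'.
  have -> : s' = s a + fK f * tau a by rewrite s'E; ring.
  apply: locD; first exact: ss.
  by apply: (locMe _ (loc_poly _ hf) (htau a)); ring.
have : loc set0 d s'.
  have -> : set0 = [set o0] :&: [set o1] by apply/setP; apply: I3P; rewrite !inE.
  by apply: loc_cap => //; right.
move=> /loc_set0P[m [g [[md] hg s'g]]]; rewrite {m}md in hg.
exists g, (fun a => v a + t a); split=> //; split.
- by move=> a i; rewrite mxE; apply: locD; [apply: vs|have [+ _] := ts a; apply].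
- move=> a; rewrite toND -s'g.
  have -> : toN f (v a) + toN f (t a) - s' = (toN f (v a) - s a) + toN f (t a) - fK f *
      tau a.
    by rewrite s'E; ring.
  apply: vanD; first by apply: vanD; [apply: vn|have [_ +] := ts a].
  by apply/vanN/van_f.
move=> a b; have := tn a b; congr nulT; rewrite /=.
by apply/rowP => i; rewrite !mxE; ring.
Qed.

Lemma pair_gt0 (a b : 'I_3) : (0 < #|[set a; b]|)%N.
Proof. by apply/card_gt0P; exists a; rewrite !inE eqxx. Qed.

Lemma pairl (a b : 'I_3) : [set a] \subset [set a; b].
Proof. exact: subsetUl. Qed.

Lemma pairr (a b : 'I_3) : [set b] \subset [set a; b].
Proof. exact: subsetUr. Qed.

(** On overlaps w a . (v b - v a) = (w b . v b - w a . v a) + (w a - w b) . v b, and the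
    last term is u a b df . v b = u a b s modulo f. *)
Lemma cup_class (xi : 'I_3 -> 'I_3 -> amb (TF d f)) s v
    (w : 'I_3 -> amb (omegaF d f)) (u : 'I_3 -> 'I_3 -> K) :
    s \is d.-homog -> planar_lift xi s v -> H0 w ->
    (forall a b, loc [set a; b] (- d%:Z) (u a b)) ->
    (forall a b i, van d f (-1) [set a; b]
       ((w a : 'rV[K]_3) 0 i - (w b : 'rV[K]_3) 0 i - u a b * dfK f i)) ->
  exists r : 'I_3 -> K, (forall a, loc [set a] 0 (r a)) /\
    forall a b, van d f 0 [set a; b]
      (cup xi w a b - (r b - r a + u a b * toK s)).
Proof.
move=> hs [vs vn tn] [ws _] hu wu.
exists (fun a => \sum_i (w a : 'rV[K]_3) 0 i * v a 0 i); split=> [a|a b].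
  apply: loc_sum; first by left; rewrite cards1.
  by move=> i _; apply: (locMe _ ((ws a).1 i) (vs a i)).
have [c [hc ce]] := tn a b.
have -> : cup xi w a b - (\sum_i (w b : 'rV[K]_3) 0 i * v b 0 i
     - \sum_i (w a : 'rV[K]_3) 0 i * v a 0 i + u a b * toK s) =
  \sum_i (w a : 'rV[K]_3) 0 i * ((xi a b - (v b - v a)) 0 i - c * xK R i)
  + c * \sum_i (w a : 'rV[K]_3) 0 i * xK R i
  + \sum_i v b 0 i * ((w a : 'rV[K]_3) 0 i - (w b : 'rV[K]_3) 0 i - u a b * dfK f i)
  + u a b * (toN f (v b) - toK s).
  rewrite /cup /toN !sum3 !mxE; ring.
apply: vanD; first apply: vanD; first apply: vanD.
- apply: van_sum => [|i]; first exact: pair_gt0.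
  apply: (@vanMe (-1) 1) => //.
  by apply: (loc_sub (pairl _ _)); apply: (ws a).1.
- apply: (@vanMe 0 0) => //.
  by apply: (van_sub (pairl _ _)); have [] := ws a.
- apply: van_sum => [|i]; first exact: pair_gt0.
  apply: (@vanMe 1 (-1)) => //.
  by apply: (loc_sub (pairr _ _)); apply: vs.
apply: (@vanMe (- d%:Z) d) => //; first by rewrite addNr.
by apply: (van_sub (pairr _ _)); apply: vn.
Qed.
End Sheaves.

(** * The lower bound *)

Lemma dotC (K : comPzRingType) (u v : 'I_3 -> K) : dot u v = dot v u.
Proof. by apply: eq_bigr => i _; rewrite mulrC. Qed.

Lemma crossBl (K : comPzRingType) (u v w : 'I_3 -> K) i :
  cross (fun j => u j - v j) w i = cross u w i - cross v w i.
Proof. by elim/I3P: i; rewrite /cross /=; ring. Qed.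

Section Forms.
Variable R : realType.
Local Notation S := {mpoly R[i][3]}.
Local Notation K := (ratK R).
Local Notation x := (xK R).
Variables (d : nat) (f : S) (alpha : 'I_3 -> 'I_3 -> K).
Hypothesis d_ge3 : (3 <= d)%N.
Hypothesis alpha_loc : forall a i, loc [set a] (1 - d%:Z) (alpha a i).
Local Notation df := (dfK f).
Local Notation det := (det3 (alpha o0) (alpha o1) (alpha o2)).

(** The residue along F of the rational 2-form with numerator g and denominator f,
    on the chart where x_a is invertible. *)
Definition poincare_residue (g : S) (a : 'I_3) : 'rV[K]_3 :=
  \row_i (toK g * cross (alpha a) x i).

(** The multiple of df by which two local expressions of a residue differ modulo
    f. *)
Definition conormal (g : S) (a b : 'I_3) : K :=
  - (toK g * dot (cross (alpha a) (alpha b)) x).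

Lemma conormal_loc g a b : g \is (d - 3).-homog ->
  loc [set a; b] (- d%:Z) (conormal g a b).
Proof.
move=> hg; apply: locN; apply: (locMe (n2 := (1 - d%:Z) *+ 2 + 1) _ (loc_poly _ hg)).
  lia.
apply: (loc_dot (n1 := (1 - d%:Z) *+ 2) (n2 := 1)) => // [i|i]; last exact: locX.
by apply: loc_cross => // j; [apply: (loc_sub (pairl a b))|apply: (loc_sub (pairr a b))].
Qed.

Hypothesis hf : f \is d.-homog.
Hypothesis alpha_df : forall a, dot (alpha a) (dfK f) = 1.

(** With gamma the cross product of two of the alpha, the difference of those two is
    the cross product of df and gamma, and taking the cross product with X gives
    (df . X) gamma - (gamma . X) df, where df . X = d f by Euler. *)
Lemma poincare_residue_diff g a b i :
  poincare_residue g a 0 i - poincare_residue g b 0 i - conormal g a b * df i =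
  fK f * (d%:R * toK g * cross (alpha a) (alpha b) i).
Proof.
rewrite !mxE -mulrBr -crossBl.
have -> : (fun j => alpha a j - alpha b j) = cross df (cross (alpha a) (alpha b)).
  by apply/funext => j; rewrite crossC cross_alpha_df // opprB.
by rewrite cross_cross (dotC df) (euler hf) /conormal /fK; ring.
Qed.

Lemma poincare_residue_van g a b i : g \is (d - 3).-homog ->
  van d f (-1) [set a; b] (poincare_residue g a 0 i - poincare_residue g b 0 i
     - conormal g a b * df i).
Proof.
move=> hg; rewrite poincare_residue_diff; apply: van_f; rewrite -mulrA.
apply: (@locMe _ _ 0 (-1 - d%:Z)) => //; first by rewrite add0r.
  by rewrite -(rmorph_nat (@constK R)); apply: loc_const.
apply: (locMe (n2 := (1 - d%:Z) *+ 2) _ (loc_poly _ hg)); first lia.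
by apply: loc_cross => // j; [apply: (loc_sub (pairl a b))|apply: (loc_sub (pairr a b))].
Qed.

Lemma poincare_residue_H0 g : g \is (d - 3).-homog ->
  @H0 R (omegaF d f) (poincare_residue g).
Proof.
move=> hg; split=> [a|a b].
  split=> [i|].
    rewrite mxE; apply: (locMe (n2 := 1 - d%:Z + 1) _ (loc_poly _ hg)); first lia.
    by apply: loc_cross => // j; apply: locX.
  have -> : \sum_i poincare_residue g a 0 i * x i = 0.
    transitivity (toK g * dot (cross (alpha a) x) x); last by rewrite dot_cross mulr0.
    by rewrite /dot mulr_sumr; apply: eq_bigr => i _; rewrite mxE mulrA.
  by apply: van0; rewrite cards1.
exists (conormal g a b); split=> [|i]; first exact: conormal_loc.
by have := poincare_residue_van a b i hg; rewrite !mxE.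
Qed.

(** The three cross products add up to det df. *)
Lemma conormal_sum g :
  conormal g o0 o1 + conormal g o1 o2 + conormal g o2 o0 = - (d%:R * toK g * fK f * det).
Proof.
rewrite /conormal -!opprD -!mulrDr; congr (- _).
have -> : dot (cross (alpha o0) (alpha o1)) x + dot (cross (alpha o1) (alpha o2)) x +
    dot (cross (alpha o2) (alpha o0)) x = det * dot df x.
  rewrite /dot mulr_sumr -!big_split; apply: eq_bigr => i _ /=.
  by rewrite mulrA det_df // !mulrDl.
by rewrite dotC (euler hf) /fK; ring.
Qed.

Hypothesis f_neq0 : f != 0.

(** Adding up over the three pairs of charts removes the coboundaries, and dividing by
    f leaves the class of the product in H^2(P^2, O(-d)). *)
Lemma cup_B1_trivial (xi : 'I_3 -> 'I_3 -> amb (TF d f)) s v g :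
  s \is d.-homog -> planar_lift d f xi s v -> g \is (d - 3).-homog ->
  @B1 R (OF d f 0) (cup xi (poincare_residue g : 'I_3 -> amb (omegaF d f))) ->
  cech_trivial (toK (g * s) * det).
Proof.
move=> hs lift hg [rho [hrho cupE]].
have [|r [hr cupE']] := cup_class hs lift (poincare_residue_H0 hg)
    (fun a b => conormal_loc a b hg).
  by move=> a b i; apply: poincare_residue_van.
have key a b : exists k, loc [set a; b] (- d%:Z) k /\
    conormal g a b * toK s = fK f * k + (rho b - r b) - (rho a - r a).
  have [e [he eE]] := cupE' a b; have [e' [he' eE']] := cupE a b.
  exists (e' - e); split; first by rewrite -[- _]add0r; apply: locB.
  by rewrite mulrBr -eE -eE'; ring.
have [k01 [h01 E01]] := key o0 o1.
have [k12 [h12 E12]] := key o1 o2.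
have [k20 [h20 E20]] := key o2 o0.
have d0 : d%:R != 0 :> R[i] by rewrite pnatr_eq0; lia.
have fK0 : fK f != 0 by rewrite toK_eq0.
pose c := constK (- d%:R^-1 : R[i]).
have cd : c * d%:R = -1.
  by rewrite -(rmorph_nat (@constK R)) -rmorphM mulNr mulVf // rmorphN1.
exists (- d%:Z), (fun i => c * match val i with 0 => k12 | 1 => k20 | _ => k01 end); split.
  apply: I3P; apply: (locMe (n1 := 0)) (loc_const _ _) _; rewrite ?add0r //=.
  - by move: h12; congr loc; apply/setP; apply: I3P; rewrite !inE.
  - by move: h20; congr loc; apply/setP; apply: I3P; rewrite !inE.
  - by move: h01; congr loc; apply/setP; apply: I3P; rewrite !inE.
apply: (mulfI fK0); rewrite sum3 /= -!mulrDr [RHS]mulrCA.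
have <- : (conormal g o0 o1 + conormal g o1 o2 + conormal g o2 o0) * toK s =
   fK f * (k12 + k20 + k01) by rewrite !mulrDl E01 E12 E20; ring.
rewrite conormal_sum rmorphM.
transitivity (- (c * d%:R) * (fK f * (toK g * toK s * det))); last by ring.
by rewrite cd opprK mul1r.
Qed.

(** If s were in the Jacobian ideal, s = u . df, then subtracting the global vector
    field u from the lifts would make xi a coboundary. *)
Theorem planar_rank_lower (xi : 'I_3 -> 'I_3 -> amb (TF d f)) : (5 <= d)%N ->
    smooth_plane_curve d f -> planar_deformation xi ->
  @rank_at_least R (omegaF d f) (OF d f 0) (cup xi) (d - 3).
Proof.
move=> d5 smf [_ xiB xiP].
have [s [v [hs lift]]] := planar_lift_ex hf f_neq0 xiP.
have [|g hg gI] := independent_products d5 hf alpha_loc alpha_df smf hs.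
  move=> [u hu su]; apply: xiB.
  have [vs vn vx] := lift; exists (fun a => v a - \row_i u i).
  split=> [a|a b]; last by have := vx a b; congr nulT; apply/rowP => i; rewrite !mxE; ring.
  split=> [i|]; first by rewrite !mxE; apply: locB => //; apply: loc0n0.
  rewrite toND; have -> : toN f (- \row_i u i) = - toK s.
    rewrite su /toN /dot -sumrN; apply: eq_bigr => i _.
    by rewrite !mxE mulrN mulrC.
  exact: vn.
exists (fun k => poincare_residue (g k) : 'I_3 -> amb (omegaF d f)); split=> [k|c cB].
  exact: poincare_residue_H0.
apply: gI; apply: (cup_B1_trivial hs lift).
  by apply: rpred_sum => k _; apply: rpredZ; apply: hg.
move: cB; congr B1; apply/funext => a; apply/funext => b.
rewrite /cup; under eq_bigr do rewrite scaler_sumr.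
rewrite exchange_big /=; apply: eq_bigr => i _.
rewrite mxE rmorph_sum !mulr_suml; apply: eq_bigr => k _.
rewrite mxE -mul_mpolyC rmorphM -[LHS]/(constK (c k) * (toK (g k) * _ * _)).
by rewrite !mulrA.
Qed.
End Forms.

(** * Cup products with arbitrary sections of the canonical bundle *)

Section Upper.
Variable R : realType.
Local Notation S := {mpoly R[i][3]}.
Local Notation K := (ratK R).
Variables (d : nat) (f : S) (alpha : 'I_3 -> 'I_3 -> K).
Hypothesis d_gt0 : (0 < d)%N.
Hypothesis hf : f \is d.-homog.
Hypothesis f_neq0 : f != 0.
Hypothesis alpha_loc : forall a i, loc [set a] (1 - d%:Z) (alpha a i).
Hypothesis alpha_df : forall a, dot (alpha a) (dfK f) = 1.
Local Notation df := (dfK f).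

Lemma vanZ (c : R[i]) n I q : van d f n I q -> van d f n I (constK c * q).
Proof. by apply: (vanMe (add0r _)); apply: loc_const. Qed.

(** A cochain u of multiples of df by which the local expressions of w differ, chosen
    antisymmetric so that the pairs (0, 1), (1, 2), (2, 0) determine it. *)
Definition is_conormal (w : 'I_3 -> 'rV[K]_3) (u : 'I_3 -> 'I_3 -> K) :=
  [/\ forall a b, u b a = - u a b,
      forall a b, loc [set a; b] (- d%:Z) (u a b) &
      forall a b i, van d f (-1) [set a; b] (w a 0 i - w b 0 i - u a b * df i)].

(** Half the difference of the two choices on an overlap is antisymmetric. *)
Lemma conormal_ex (w : 'I_3 -> amb (omegaF d f)) : H0 w ->
  exists u, is_conormal w u.
Proof.
move=> [_ hw].
have /choice[u hu] : forall p : 'I_3 * 'I_3, exists u : K,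
    loc [set p.1; p.2] (- d%:Z) u /\ forall i, van d f (-1) [set p.1; p.2]
      ((w p.1 : 'rV[K]_3) 0 i - (w p.2 : 'rV[K]_3) 0 i - u * df i).
  by move=> [a b]; have [u [hu vu]] := hw a b; exists u; split=> // i; have := vu i;
      rewrite !mxE.
pose h : K := constK (2%:R^-1).
have h2 : h * 2%:R = 1.
  by rewrite -(rmorph_nat (@constK R)) -rmorphM mulVf ?pnatr_eq0 // rmorph1.
exists (fun a b => h * (u (a, b) - u (b, a))); split=> [a b|a b|a b i].
- by ring.
- apply: (locMe (add0r _) (loc_const _ _)); apply: locB; first by have [] := hu (a, b).
  by rewrite setUC; have [] := hu (b, a).
have -> : (w a : 'rV[K]_3) 0 i - (w b : 'rV[K]_3) 0 i - h * (u (a, b) - u (b, a)) * df i =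
   h * (((w a : 'rV[K]_3) 0 i - (w b : 'rV[K]_3) 0 i - u (a, b) * df i) -
        ((w b : 'rV[K]_3) 0 i - (w a : 'rV[K]_3) 0 i - u (b, a) * df i)).
  by rewrite -[X in X - _ - _ = _]mul1r -[X in _ - X - _ = _]mul1r -h2; ring.
apply: vanZ; apply: vanD; first by have [_] := hu (a, b); apply.
by apply: vanN; rewrite setUC; have [_] := hu (b, a); apply.
Qed.

(** The differences of w around the three charts cancel, so the sum of u times df is a
    multiple of f; multiplying by a vector alpha with alpha . df = 1 shows that the
    sum itself is one.  The quotient tau is the image of w in H^2(P^2, O(-2d));
    dividing the componentwise identity by f shows that each df i kills it. *)
Lemma conormal_residue w u : is_conormal w u ->
  exists tau, [/\ loc setT (- (d%:Z *+ 2)) tau,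
    u o0 o1 + u o1 o2 + u o2 o0 = fK f * tau &
    forall i, cech_trivial (df i * tau)].
Proof.
move=> [_ _ vu].
have fK0 : fK f != 0 by rewrite toK_eq0.
have /choice[k hk] : forall i, exists k : 'I_3 -> K,
    (forall j, loc (setT :\ j) (-1 - d%:Z) (k j)) /\
    df i * (u o0 o1 + u o1 o2 + u o2 o0) = fK f * (\sum_j k j).
  move=> i; have [k01 [h01 e01]] := vu o0 o1 i.
  have [k12 [h12 e12]] := vu o1 o2 i; have [k20 [h20 e20]] := vu o2 o0 i.
  exists (fun j => - match val j with 0 => k12 | 1 => k20 | _ => k01 end); split.
    apply: I3P; apply: locN => /=.
    - by move: h12; congr loc; apply/setP; apply: I3P; rewrite !inE.
    - by move: h20; congr loc; apply/setP; apply: I3P; rewrite !inE.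
    - by move: h01; congr loc; apply/setP; apply: I3P; rewrite !inE.
  by rewrite sum3 /= !mulrDr !mulrN -e01 -e12 -e20; ring.
pose tau := \sum_i alpha o0 i * (\sum_j k i j).
have uE : u o0 o1 + u o1 o2 + u o2 o0 = fK f * tau.
  rewrite /tau mulr_sumr -[LHS]mul1r -(alpha_df o0) /dot mulr_suml.
  by apply: eq_bigr => i _; have [_ e] := hk i; rewrite -mulrA e; ring.
exists tau; split=> // [|i].
  apply: loc_sum => [|i _]; first by left; rewrite cardsT card_ord.
  apply: (@locMe _ _ (1 - d%:Z) (-1 - d%:Z)); first by ring.
    by apply: loc_singleton (alpha_loc _ _); rewrite inE.
  apply: loc_sum => [|j _]; first by left; rewrite cardsT card_ord.
  by apply: loc_sub (subsetT _) _; have [+ _] := hk i; apply.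
have [hk1 hk2] := hk i; exists (-1 - d%:Z), (k i); split=> //.
by apply: (mulfI fK0); rewrite -hk2 uE; ring.
Qed.

(** If s tau is trivial then correcting u s by multiples of f turns it into a
    cocycle for O on the plane, which is a coboundary. *)
Lemma cup_coboundary (xi : 'I_3 -> 'I_3 -> amb (TF d f)) s v
    (w : 'I_3 -> amb (omegaF d f)) u tau b :
    s \is d.-homog -> planar_lift d f xi s v -> H0 w -> is_conormal w u ->
    u o0 o1 + u o1 o2 + u o2 o0 = fK f * tau ->
    (forall i, loc (setT :\ i) (- d%:Z) (b i)) -> toK s * tau = \sum_i b i ->
  @B1 R (OF d f 0) (cup xi w).
Proof.
move=> hs lift hw [ua ul uv] uE hb; rewrite sum3 => sE.
have [r [hr cupE]] := cup_class hs lift hw ul uv.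
have hbl (i a e : 'I_3) : setT :\ i = [set a; e] -> loc [set a; e] 0 (fK f * b i).
  by move=> <-; apply: (locMe _ (loc_poly _ hf) (hb i)); rewrite subrr.
have hus a e : loc [set a; e] 0 (u a e * toK s).
  by apply: (locMe _ (ul a e) (loc_poly _ hs)); rewrite addNr.
have [||||rho hrho [E01 E12 E02]] := @cocycle01 R 0 (u o0 o1 * toK s - fK f * b o2)
   (u o1 o2 * toK s - fK f * b o0) (u o0 o2 * toK s + fK f * b o1).
- by apply: locB => //; apply: hbl; apply/setP; apply: I3P; rewrite !inE.
- by apply: locB => //; apply: hbl; apply/setP; apply: I3P; rewrite !inE.
- by apply: locD => //; apply: hbl; apply/setP; apply: I3P; rewrite !inE.
- rewrite (ua o2 o0); apply/subr0_eq.
  transitivity ((u o0 o1 + u o1 o2 + u o2 o0) * toK s - fK f * (b o0 + b o1 + b o2));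
      first ring.
  by rewrite -sE uE; ring.
have Ps a e : van d f 0 [set a; e] (u a e * toK s - (rho e - rho a)) ->
    van d f 0 [set e; a] (u e a * toK s - (rho a - rho e)).
  move=> /vanN; rewrite setUC; congr (van _ _ _ _ _).
  by rewrite (ua a e); ring.
have P0 a : van d f 0 [set a; a] (u a a * toK s - (rho a - rho a)).
  have -> : u a a = 0.
    have : u a a * constK 2%:R == 0.
      by rewrite rmorph_nat mulr_natr mulr2n {2}(ua a a) subrr.
    by rewrite mulf_eq0 toK_eq0 mpolyC_eq0 pnatr_eq0 orbF => /eqP.
  by rewrite mul0r subrr subr0; apply: van0; apply: pair_gt0.
have P01 : van d f 0 [set o0; o1] (u o0 o1 * toK s - (rho o1 - rho o0)).
  rewrite -E01; exists (b o2); split; last by ring.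
  by rewrite sub0r; move: (hb o2); congr loc; apply/setP; apply: I3P; rewrite !inE.
have P12 : van d f 0 [set o1; o2] (u o1 o2 * toK s - (rho o2 - rho o1)).
  rewrite -E12; exists (b o0); split; last by ring.
  by rewrite sub0r; move: (hb o0); congr loc; apply/setP; apply: I3P; rewrite !inE.
have P02 : van d f 0 [set o0; o2] (u o0 o2 * toK s - (rho o2 - rho o0)).
  rewrite -E02; exists (- b o1); split; last by ring.
  apply: locN.
  by rewrite sub0r; move: (hb o1); congr loc; apply/setP; apply: I3P; rewrite !inE.
exists (fun a => r a + rho a); split=> [a|a e]; first exact: locD.
have Pall a' e' : van d f 0 [set a'; e'] (u a' e' * toK s - (rho e' - rho a')).
  by elim/I3P: a'; elim/I3P: e'; auto.
have := vanD (cupE a e) (Pall a e); congr (van _ _ _ _ _); rewrite /=; ring.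
Qed.
End Upper.

(** * A deformation of the Fermat curve *)

Section Fermat.
Variable R : realType.
Local Notation S := {mpoly R[i][3]}.
Local Notation K := (ratK R).
Variable d : nat.
Hypothesis d_ge5 : (5 <= d)%N.
Local Notation f := (fermat R d).
Local Notation df := (dfK f).

Lemma fermat_homog : f \is d.-homog.
Proof.
apply: rpred_sum => i _; rewrite mpolyXn dhomogX /= mdegMn mdeg1 mul1n //.
Qed.

Lemma fermat_deriv i : f^`M(i) = d%:R *: 'X_[U_(i) *+ d.-1].
Proof.
rewrite /fermat raddf_sum (bigD1 i) //= big1 ?addr0 => [|j ji].
  rewrite mpolyXn mderivX mulmnE mnm1E eqxx mul1n; congr (_ *: 'X_[_]).
  by apply/mnmP => j; rewrite mnmBE !mulmnE mnm1E; case: eqP; lia.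
by rewrite mpolyXn mderivX mulmnE mnm1E (negPf ji) mul0n scale0r.
Qed.

Lemma fermat_df i : df i = constK d%:R * xmon R (U_(i) *+ d.-1).
Proof. by rewrite /dfK fermat_deriv -mul_mpolyC rmorphM. Qed.

Let dC0 : (d%:R : R[i]) != 0. Proof. by rewrite pnatr_eq0; lia. Qed.

Lemma fermat_smooth : smooth_plane_curve d f.
Proof.
split=> [|p [i pi] _]; first exact: fermat_homog.
exists i; rewrite fermat_deriv mevalZ mulf_neq0 // -mpolyXn rmorphXn /=.
by rewrite mevalXU expf_neq0.
Qed.

Lemma fermat_neq0 : f != 0.
Proof.
apply: contraNneq dC0 => f0; have := fermat_deriv o0; rewrite f0 raddf0.
move=> /(congr1 (mcoeff (U_(o0) *+ d.-1)%MM)).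
by rewrite mcoeff0 mcoeffZ mcoeffX eqxx mulr1 => <-.
Qed.

(** The partial derivatives are d x_i^(d-1), so one coordinate suffices on each
    chart. *)
Definition fermat_alpha (a i : 'I_3) : K :=
  if i == a then constK d%:R^-1 / xmon R (U_(a) *+ d.-1) else 0.

Lemma fermat_alpha_loc a i : loc [set a] (1 - d%:Z) (fermat_alpha a i).
Proof.
rewrite /fermat_alpha; case: eqP => _; last by apply: loc0; left; rewrite cards1.
apply: (locMe (add0r _) (loc_const _ _)); apply/locP.
exists d.-1, 0%N, 1; split; first exact: dhomog1.
  by rewrite cards1; lia.
by rewrite rmorph1 mul1r /mnm_set big_set1.
Qed.

Lemma fermat_alpha_df a : dot (fermat_alpha a) df = 1.
Proof.
rewrite /dot (bigD1 a) //= big1 => [|i /negPf ia]; last by rewrite /fermat_alpha ia mul0r.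
rewrite /fermat_alpha eqxx addr0 fermat_df mulrACA -rmorphM mulVf // rmorph1 mul1r.
by rewrite mulVf // xmon_neq0.
Qed.

Lemma fermat_alpha_det : det3 (fermat_alpha o0) (fermat_alpha o1) (fermat_alpha o2) =
  constK (d%:R^-1 ^+ 3) / xmon R (mnm_set setT *+ d.-1).
Proof.
have -> : mnm_set setT = (U_(o0) + U_(o1) + U_(o2))%MM.
  apply/mnmP => i; rewrite mnm_setE inE !mnmDE !mnm1E.
  by elim/I3P: i.
have -> : ((U_(o0) + U_(o1) + U_(o2)) *+ d.-1 =
   U_(o0) *+ d.-1 + U_(o1) *+ d.-1 + U_(o2) *+ d.-1 :> 'X_{1..3})%MM.
  by apply/mnmP => i; rewrite !(mulmnE, mnmDE) !mulnDl.
rewrite /det3 /dot sum3 /cross /fermat_alpha /= !xmonD !invfM rmorphXn /=; ring.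
Qed.

(** The form x_0^2 x_1^(d-2): modulo the Jacobian ideal it is killed by x_1 and by
    x_0^(d-3), which makes the rank small. *)
Definition fermat_form : S := 'X_[U_(o0) *+ 2 + U_(o1) *+ (d - 2)].

Lemma fermat_form_homog : fermat_form \is d.-homog.
Proof. by rewrite dhomogX /= mdegD !mdegMn !mdeg1; apply/eqP; lia. Qed.

Definition fermat_lift (a : 'I_3) : 'rV[K]_3 := \row_i (toK fermat_form * fermat_alpha a i).
Definition fermat_deformation (a b : 'I_3) : amb (TF d f) := fermat_lift b - fermat_lift a.

Lemma fermat_lift_toN a : toN f (fermat_lift a) = toK fermat_form.
Proof.
rewrite -[RHS]mulr1 -(fermat_alpha_df a) /toN /dot mulr_sumr.
by apply: eq_bigr => i _; rewrite mxE; ring.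
Qed.

Lemma fermat_lift_loc a i : loc [set a] 1 (fermat_lift a 0 i).
Proof.
by rewrite mxE; apply: (locMe _ (loc_poly _ fermat_form_homog) (fermat_alpha_loc a i));
    ring.
Qed.

Lemma nulT0 (I : {set 'I_3}) : (0 < #|I|)%N -> nulT d f I 0.
Proof.
move=> I0; exists 0; split; first by apply: loc0; left.
by move=> i; rewrite mxE mul0r subrr; apply: van0.
Qed.

Lemma fermat_deformation_lift : planar_lift d f fermat_deformation fermat_form fermat_lift.
Proof.
split=> [a i|a|a b]; first exact: fermat_lift_loc.
  by rewrite fermat_lift_toN subrr; apply: van0; rewrite cards1.
by rewrite subrr; apply: nulT0; apply: pair_gt0.
Qed.

(** If the deformation were trivial, the zero form would also lift it, and all cup
    products would vanish; but the product with x_0^(d-4) x_2 has a nonzero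
    residue. *)
Lemma fermat_deformation_nontrivial : ~ @B1 R (TF d f) fermat_deformation.
Proof.
move=> [t [ht nt]].
(* A trivialization t of the deformation is a lift of the zero form. *)
have lift0 : planar_lift d f fermat_deformation 0 t.
  split=> [a i|a|a b]; first by have [] := ht a.
    by rewrite rmorph0 subr0; have [] := ht a.
  exact: nt.
pose g : S := 'X_[U_(o0) *+ (d - 4) + U_(o2)].
have hg : g \is (d - 3).-homog.
  by rewrite dhomogX /= mdegD mdegMn !mdeg1; apply/eqP; lia.
have d3 : (3 <= d)%N by lia.
have hW := poincare_residue_H0 d3 fermat_alpha_loc fermat_homog fermat_alpha_df hg.
have [|r [hr cE]] := cup_class (rpred0 _) lift0 hW
   (fun a b => conormal_loc d3 fermat_alpha_loc a b hg).
  by move=> a b i; apply: (poincare_residue_van d3 fermat_alpha_loc fermat_homog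
      fermat_alpha_df).
have := cup_B1_trivial d3 fermat_alpha_loc fermat_homog fermat_alpha_df fermat_neq0
    fermat_form_homog fermat_deformation_lift hg.
case.
  exists r; split=> // a b; have := cE a b; rewrite rmorph0 mulr0 addr0; exact.
move=> n [b [hb E]].
have : (d%:R^-1 ^+ 3 *: (g * fermat_form))@_(U_(o0) *+ (d - 2) + U_(o1) *+ (d - 2) +
    U_(o2))%MM = 0.
  apply: (loc_sum_coef (subxx setT) hb (N := d.-1)).
    rewrite -mul_mpolyC rmorphM -/(constK _) mulrAC mulrC -fermat_alpha_det E.
    by apply: eq_bigl => i; rewrite inE.
  move=> i _; rewrite !mnmDE !mulmnE !mnm1E; elim/I3P: i => /=; lia.
have mE : (U_(o0) *+ (d - 4) + U_(o2) + (U_(o0) *+ 2 + U_(o1) *+ (d - 2)) =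
    U_(o0) *+ (d - 2) + U_(o1) *+ (d - 2) + U_(o2) :> 'X_{1..3})%MM.
  apply/mnmP => i; rewrite !(mnmDE, mulmnE, mnm1E); elim/I3P: i => /=; lia.
apply/eqP; rewrite mcoeffZ /g /fermat_form -mpolyXD mE mcoeffX eqxx.
by rewrite mulf_neq0 ?oner_eq0 // expf_neq0 // invr_neq0.
Qed.

Lemma fermat_deformation_planar : planar_deformation fermat_deformation.
Proof.
split; last 1 first.
- exists (fun=> toK fermat_form), fermat_lift; split=> //.
  + split=> [a|a b]; first exact/loc_poly/fermat_form_homog.
    by rewrite subrr; apply: van0; apply: pair_gt0.
  + by move=> a; exact: (fermat_lift_loc a).
  + by move=> a; rewrite fermat_lift_toN subrr; apply: van0; rewrite cards1.
  exists (fun=> 0); split=> [a|a b].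
    split=> [i|]; first by rewrite mxE; apply: loc0; left; rewrite cards1.
    by rewrite /toN big1 => [|i _]; [apply: van0; rewrite cards1|rewrite mxE mulr0].
  by rewrite !subrr; apply: nulT0; apply: pair_gt0.
- split=> [a b|a b e].
    split=> [i|].
      rewrite mxE; apply: locD.
        by apply: (loc_sub (pairr _ _)); apply: fermat_lift_loc.
      by rewrite mxE; apply: locN; apply: (loc_sub (pairl _ _)); apply: fermat_lift_loc.
    rewrite toND fermat_lift_toN; have -> : toN f (- fermat_lift a) = - toK fermat_form.
      by rewrite -(fermat_lift_toN a) /toN -sumrN; apply: eq_bigr => i _; rewrite mxE mulrN.
    by rewrite subrr; apply: van0; apply: pair_gt0.
  have -> : fermat_deformation a b + fermat_deformation b e - fermat_deformation a e = 0.
    by rewrite /fermat_deformation; apply/rowP => i; rewrite !mxE; ring.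
  by apply: nulT0; apply/card_gt0P; exists a; rewrite !inE eqxx.
exact: fermat_deformation_nontrivial.
Qed.
End Fermat.

(** * The upper bound for the Fermat curve *)

Section Combination.
Variables (R : realType) (d : nat) (f : {mpoly R[i][3]}) (r : nat).
Local Notation K := (ratK R).
Variables (c : 'I_r -> R[i]) (w : 'I_r -> 'I_3 -> amb (omegaF d f)).
Variable (u : 'I_r -> 'I_3 -> 'I_3 -> K).

Definition comb_form (a : 'I_3) : amb (omegaF d f) := \sum_k constK (c k) *: w k a.
Definition comb_fun (a b : 'I_3) : K := \sum_k constK (c k) * u k a b.

Lemma comb_formE a i : (comb_form a : 'rV[K]_3) 0 i =
  \sum_k constK (c k) * (w k a : 'rV[K]_3) 0 i.
Proof. by rewrite /comb_form summxE; apply: eq_bigr => k _; rewrite mxE. Qed.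

Lemma van_sumr n (I : {set 'I_3}) (F : 'I_r -> K) : (0 < #|I|)%N ->
  (forall k, van d f n I (F k)) -> van d f n I (\sum_k constK (c k) * F k).
Proof.
move=> I0 hF; elim/big_ind: _ => [|x y|k _]; first exact: van0.
  exact: vanD.
exact: vanZ.
Qed.

Lemma loc_sumr n (I : {set 'I_3}) (F : 'I_r -> K) : (0 < #|I|)%N ->
  (forall k, loc I n (F k)) -> loc I n (\sum_k constK (c k) * F k).
Proof.
move=> I0 hF; apply: loc_sum => [|k _]; first by left.
by apply: (locMe (add0r _) (loc_const _ _)).
Qed.

Lemma comb_conormal : (forall k, is_conormal d f (w k) (u k)) ->
  is_conormal d f comb_form comb_fun.
Proof.
move=> wu; split=> [a b|a b|a b i].
- by rewrite /comb_fun -sumrN; apply: eq_bigr => k _; have [-> _ _] := wu k; rewrite mulrN.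
- by apply: loc_sumr => [|k]; [apply: pair_gt0|have [_ + _] := wu k].
rewrite !comb_formE /comb_fun mulr_suml -!sumrB.
under eq_bigr do rewrite -mulrA -!mulrBr.
by apply: van_sumr => [|k]; [apply: pair_gt0|have [_ _] := wu k].
Qed.

Lemma comb_H0 : (forall k, H0 (w k)) -> (forall k, is_conormal d f (w k) (u k)) ->
  H0 comb_form.
Proof.
move=> hw /comb_conormal[_ hl hv]; split=> [a|a b].
  have ws k := (hw k).1 a; split=> [i|].
    rewrite comb_formE; apply: loc_sumr => [|k]; first by rewrite cards1.
    by have [] := ws k.
  under eq_bigr do rewrite comb_formE mulr_suml.
  rewrite exchange_big /=; under eq_bigr do under eq_bigr do rewrite -mulrA.
  under eq_bigr do rewrite -mulr_sumr.
  apply: van_sumr => [|k]; first by rewrite cards1.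
  by have [] := ws k.
by exists (comb_fun a b); split=> // i; have := hv a b i; rewrite !mxE.
Qed.

Lemma cup_comb (xi : 'I_3 -> 'I_3 -> amb (TF d f)) a b :
  cup xi comb_form a b = \sum_k constK (c k) *: cup xi (w k) a b.
Proof.
rewrite /cup; under [RHS]eq_bigr do rewrite scaler_sumr.
rewrite exchange_big /=; apply: eq_bigr => i _; rewrite comb_formE mulr_suml.
by apply: eq_bigr => k _; rewrite -[RHS]/(constK (c k) * (_ * _)) mulrA.
Qed.
End Combination.

Section FermatUpper.
Variables (R : realType) (d : nat).
Hypothesis d_ge5 : (5 <= d)%N.
Local Notation S := {mpoly R[i][3]}.
Local Notation K := (ratK R).
Local Notation f := (fermat R d).

Let dC0 : (d%:R : R[i]) != 0. Proof. by rewrite pnatr_eq0; lia. Qed.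

(** The class of the product with w is determined by the coefficients of tau at the
    d - 3 monomials mu j; a combination of more than d - 3 sections for which they
    all vanish has trivial product. *)
Lemma fermat_rank_upper r :
    @rank_at_least R (omegaF d f) (OF d f 0) (cup (@fermat_deformation R d)) r ->
  (r <= d - 3)%N.
Proof.
move=> [w [hw ind]]; rewrite leqNgt; apply/negP => lt_r.
have /choice[u hu] : forall k, exists u, is_conormal d f (w k) u.
  by move=> k; apply: conormal_ex.
have /choice[tau htau] := fun k =>
  conormal_residue (fermat_neq0 R d_ge5) (@fermat_alpha_loc R d d_ge5) (fermat_alpha_df R
      d_ge5) (hu k).
pose P k n0 := forall n, (n0 <= n)%N -> exists m (g : S), [/\ g \is m.-homog,
   m%:Z = - (d%:Z *+ 2) + (n * #|[set: 'I_3]|)%:Z & tau k = toK g / xmon R (mnm_set setT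
       *+ n)].
have /choice[n0 hn0] : forall k, exists n0, P k n0.
  by move=> k; apply: loc_large; have [] := htau k.
(* A common denominator for all the tau k, large enough for the truncated
   subtractions in mu below. *)
pose M := (\max_k n0 k + d)%N.
pose m := (3 * M - 2 * d)%N.
have /choice[G hG] : forall k, exists g : S,
    g \is m.-homog /\ tau k = toK g / xmon R (mnm_set setT *+ M).
  move=> k; have [|m' [g [hg dm tg]]] := hn0 k M.
    by apply: leq_trans (leq_addr _ _); apply: leq_bigmax.
  exists g; split=> //; suff <- : m' = m by [].
  by move: dm; rewrite cardsT card_ord /m /M; lia.
(* x_i^(d-1) kills the class of tau k. *)
have low k (mu : 'X_{1..3}) i :
    (forall j, mu j < M)%N -> (mu i + d.-1 < M)%N -> (G k)@_mu = 0.
  move=> mu_lt mui; have [_ _ /(_ i)[n [b [hb E]]]] := htau k.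
  have : (d%:R *: (G k * 'X_[U_(i) *+ d.-1]))@_(U_(i) *+ d.-1 + mu)%MM = 0.
    apply: (loc_sum_coef (subxx setT) hb (N := M)).
      rewrite -mul_mpolyC !rmorphM /= -/(constK _) -/(xmon R _).
      rewrite [RHS](_ : _ = \sum_i b i); last by apply: eq_bigl => j; rewrite inE.
      rewrite -E fermat_df //; have [_ ->] := hG k; ring.
    move=> j _; rewrite mnmDE mulmnE mnm1E; case: eqP => [<-|_].
      by rewrite /= mul1n addnC.
    by rewrite /= mul0n add0n.
  by rewrite mcoeffZ mcoeffMX => /eqP; rewrite mulf_eq0 (negPf dC0) => /eqP.
pose mu (j : nat) : 'X_{1..3} :=
  (U_(o0) *+ (M - d + 1 + j) + U_(o1) *+ (M - d + 1) + U_(o2) *+ (M - 2 - j))%MM.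
pose L : 'M[R[i]]_(r, d - 3) := \matrix_(k, j) (G k)@_(mu j).
have [c cL c0] : exists2 c : 'rV_r, (c <= kermx L)%MS & c != 0.
  apply/rowV0Pn; rewrite kermx_eq0 -row_leq_rank -ltnNge.
  exact: leq_ltn_trans (rank_leq_col _) lt_r.
have {}cL : c *m L = 0 by apply/sub_kermxP.
pose g : S := \sum_k c 0 k *: G k.
have gmu (nu : 'X_{1..3}) : g@_nu = \sum_k c 0 k * (G k)@_nu.
  by rewrite raddf_sum /=; apply: eq_bigr => k _; rewrite mcoeffZ.
have hg : g \is m.-homog by apply: rpred_sum => k _; apply: rpredZ; have [] := hG k.
pose Tau := \sum_k constK (c 0 k) * tau k.
have TauE : Tau = toK g / xmon R (mnm_set setT *+ M).
  rewrite /g rmorph_sum mulr_suml; apply: eq_bigr => k _.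
  by have [_ ->] := hG k; rewrite -mul_mpolyC rmorphM mulrA.
suff cB : B1 (fun a b =>
    \sum_(k < r) constK (c 0 k) *: cup (@fermat_deformation R d) (w k) a b).
  by move/negP: c0; apply; apply/eqP/rowP => k; rewrite mxE; apply: (ind (fun k => c 0 k)).
have [|||||b hb sb] := @loc_split R setT setT (- d%:Z) M (m + d)%N (g * fermat_form R d).
- exact: subxx.
- by rewrite cardsT card_ord.
- by apply: dhomogM => //; apply: fermat_form_homog.
- by rewrite cardsT card_ord /m /M; lia.
- move=> nu nu_lt; apply/eqP/negPn/negP => nz; have le_nu := supp_mulX nz.
  move: nz; rewrite /fermat_form -{1}(submK le_nu) addmC mcoeffMX.
  move: (nu - _)%MM (submK le_nu) => ka kaE; rewrite gmu.
  have ka0 : (ka o0 + 2 < M)%N.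
    by have := nu_lt o0; rewrite -kaE !mnmDE !mulmnE !mnm1E inE /=; lia.
  have ka1 : (ka o1 + (d - 2) < M)%N.
    by have := nu_lt o1; rewrite -kaE !mnmDE !mulmnE !mnm1E inE /=; lia.
  have ka2 : (ka o2 < M)%N.
    by have := nu_lt o2; rewrite -kaE !mnmDE !mulmnE !mnm1E inE /=; lia.
  have ka_lt : forall j, (ka j < M)%N by apply: I3P; lia.
  have [/existsP[i small]|/existsPn big] := boolP [exists i, (ka i + d.-1 < M)%N].
    by rewrite big1 ?eqxx // => k _; rewrite (low k ka i) ?mulr0.
  have [dka|dka] := eqVneq (mdeg ka) m; last first.
    rewrite big1 ?eqxx // => k _; rewrite (dhomog_nemf_coeff _ dka) ?mulr0 //.
    by have [] := hG k.
  have b0 := big o0; have b1 := big o1; have b2 := big o2.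
  move: dka; rewrite mdegE sum3 /m => dka.
  have j_lt : (ka o0 - (M - d + 1) < d - 3)%N by lia.
  have -> : ka = mu (Ordinal j_lt).
    apply/mnmP; apply: I3P; rewrite /mu !mnmDE !mulmnE !mnm1E /=; lia.
  have /rowP/(_ (Ordinal j_lt)) := cL; rewrite !mxE => sum0.
  by apply/negP/negPn/eqP; rewrite -[RHS]sum0; apply: eq_bigr => k _; rewrite mxE.
have -> : (fun a b =>
      \sum_(k < r) constK (c 0 k) *: cup (@fermat_deformation R d) (w k) a b) =
    cup (@fermat_deformation R d) (comb_form (c 0) w).
  by apply/funext => a; apply/funext => e; rewrite cup_comb.
apply: (cup_coboundary (fermat_homog R d) (fermat_form_homog R d_ge5)
    (fermat_deformation_lift R d_ge5)
  (comb_H0 (c 0) hw hu) (comb_conormal (c 0) hu) (tau := Tau) (b := b)).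
- rewrite /comb_fun -!big_split /= /Tau mulr_sumr; apply: eq_bigr => k _.
  by have [_ e _] := htau k; rewrite -!mulrDr e mulrCA.
- by move=> i; apply: hb; rewrite inE.
rewrite TauE mulrA -rmorphM [_ * g]mulrC sb.
by apply: eq_bigl => i; rewrite inE.
Qed.
End FermatUpper.

Theorem theorem1p3 (R : realType) (d : nat) (hd : (5 <= d)%N) :
  (forall (f : {mpoly R[i][3]}) (xi : 'I_3 -> 'I_3 -> amb (TF d f)),
      smooth_plane_curve d f -> planar_deformation xi ->
      @rank_at_least R (omegaF d f) (OF d f 0) (cup xi) (d - 3)) /\
  (exists xi : 'I_3 -> 'I_3 -> amb (TF d (fermat R d)),
      planar_deformation xi /\
      @has_rank R (omegaF d (fermat R d)) (OF d (fermat R d) 0) (cup xi) (d - 3)).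
Proof.
have d0 : (0 < d)%N by apply: leq_trans hd.
have d3 : (3 <= d)%N by apply: leq_trans hd.
have lower f xi : smooth_plane_curve d f -> planar_deformation xi ->
    @rank_at_least R (omegaF d f) (OF d f 0) (cup xi) (d - 3).
  move=> smf; have [alpha al adf] := inverse_gradient d0 smf.
  exact: (planar_rank_lower d3 al smf.1 adf (smooth_neq0 d0 smf)).
split; first exact: lower.
exists (@fermat_deformation R d); have planar := fermat_deformation_planar R hd; split=> //.
split; first exact/lower/planar/fermat_smooth.
by move=> r; apply: fermat_rank_upper.
Qed.
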